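(* Let $V=\coprod_{k\in\mathbb{Z}}V_{(k)}$ together with linear maps $\mathcal{Y}(x):V\to(V\otimes V)[[x,x^{-1}]]$ and $c:V\to\mathbb{F}$ satisfy all the axioms of a graded vertex coalgebra except the Jacobi identity. Put $D^*=\mathrm{Res}_x\,x^{-2}(Id_V\otimes c)\mathcal{Y}(x):V\to V$. Suppose that: (i) (weak coassociativity) for every $v'\in(V^{\otimes3})'$ there exists $k\in\mathbb{Z}_+$ such that for all $v\in V$ $$(x_0+x_2)^k\langle v',(\mathcal{Y}(x_0)\otimes Id_V)\mathcal{Y}(x_2)v-(Id_V\otimes\mathcal{Y}(x_2))\mathcal{Y}(x_0+x_2)v\rangle=0;$$ (ii) (skew-symmetry) $T\mathcal{Y}(x)=\mathcal{Y}(-x)e^{xD^*}$. Then the Jacobi identity holds: $$x_0^{-1}\delta\left(\tfrac{x_1-x_2}{x_0}\right)(Id_V\otimes\mathcal{Y}(x_2))\mathcal{Y}(x_1)-x_0^{-1}\delta\left(\tfrac{x_2-x_1}{-x_0}\right)(T\otimes Id_V)(Id_V\otimes\mathcal{Y}(x_1))\mathcal{Y}(x_2)=x_2^{-1}\delta\left(\tfrac{x_1-x_0}{x_2}\right)(\mathcal{Y}(x_0)\otimes Id_V)\mathcal{Y}(x_2).$$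
   Context: All vector spaces are over a field $\mathbb{F}$ of characteristic $0$; $x,x_0,x_1,x_2$ are commuting formal variables; $\mathbb{Z}_+$ is the set of positive integers. $\delta(x)=\sum_{n\in\mathbb{Z}}x^n$. For $n\in\mathbb{Z}$, $(x_i\pm x_j)^n$ is expanded in nonnegative integral powers of the second listed variable $x_j$ (this also applies inside $\delta$ and to $\mathcal{Y}(x_0+x_2)$). $\mathrm{Res}_x$ denotes the coefficient of $x^{-1}$, and $e^{xD^*}=\sum_{n\ge0}\frac{x^n}{n!}(D^* )^n$. $W[[x,x^{-1}]]$ is the space of all doubly infinite formal series with coefficients in $W$, and $W((x^{-1}))$ is the space of those with only finitely many positive powers of $x$. $T(u\otimes v)=v\otimes u$ on $V\otimes V$. Linear maps and pairings act on formal series coefficientwise. The axioms of a graded vertex coalgebra other than the Jacobi identity are: $V=\coprod_{k\in\mathbb{Z}}V_{(k)}$ is a $\mathbb{Z}$-graded vector space with $V_{(k)}=0$ for $k$ sufficiently negative; writing $\mathcal{Y}(x)v=\sum_{k\in\mathbb{Z}}\Delta_k(v)x^{-k-1}$, one has $\Delta_k(v)\in(V\otimes V)_{(r+k+1)}$ for all $v\in V_{(r)}$ and $r,k\in\mathbb{Z}$; and for all $v\in V$: 1. Left counit: $(c\otimes Id_V)\mathcal{Y}(x)v=v$. 2. Cocreation: $(Id_V\otimes c)\mathcal{Y}(x)v\in V[[x]]$ and $\lim_{x\to0}(Id_V\otimes c)\mathcal{Y}(x)v=v$. 3. Truncation: $\mathcal{Y}(x)v\in(V\otimes V)((x^{-1}))$.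 For a graded space $W=\coprod_k W_{(k)}$, the graded dual is $W'=\coprod_k \mathrm{Hom}(W_{(k)},\mathbb{F})$, and $\langle\cdot,\cdot\rangle$ is the natural pairing of $W'$ with $W$. $V^{\otimes n}$ is graded by total weight, and $(V^{\otimes n})'$ is its graded dual. *)

(* Defs.v *)
From HB Require Import structures.
From mathcomp Require Import all_boot all_order all_algebra.
From mathcomp Require Import all_classical.
From mathcomp Require Import zify.

Set Implicit Arguments.
Unset Strict Implicit.
Unset Printing Implicit Defensive.

Import Order.TTheory GRing.Theory Num.Theory.
Local Open Scope quotient_scope.
Local Open Scope classical_set_scope.
Local Open Scope ring_scope.

(* * Tensor product of two (possibly infinite-dimensional) vector spaces      *)

(* Finite formal sums of pairs, modulo the congruence generated by            *)
(* bilinearity. The pair (u, v) stands for the pure tensor of u and v.        *)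
Inductive tens_rel (F : fieldType) (U V : lmodType F) :
    seq (U * V) -> seq (U * V) -> Prop :=
| tens_refl s : tens_rel s s
| tens_sym s t : tens_rel s t -> tens_rel t s
| tens_trans s t r : tens_rel s t -> tens_rel t r -> tens_rel s r
| tens_cat s s' t t' :
    tens_rel s s' -> tens_rel t t' -> tens_rel (s ++ t) (s' ++ t')
| tens_comm s t : tens_rel (s ++ t) (t ++ s)
| tens_zero v : tens_rel [:: (0, v)] [::]
| tens_addl u u' v : tens_rel [:: (u + u', v)] [:: (u, v); (u', v)]
| tens_addr u v v' : tens_rel [:: (u, v + v')] [:: (u, v); (u, v')]
| tens_scale a u v : tens_rel [:: (a *: u, v)] [:: (u, a *: v)].

Section Tensor.
Context (F : fieldType) (U V : lmodType F).
Implicit Types s t : seq (U * V).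

Definition tens_relb : rel (seq (U * V)) := fun s t => `[< tens_rel s t >].

Fact tens_relb_refl : reflexive tens_relb.
Proof. by move=> s; apply/asboolP; exact: tens_refl. Qed.

Fact tens_relb_sym : symmetric tens_relb.
Proof.
by move=> s t; apply/asboolP/asboolP => h; exact: tens_sym.
Qed.

Fact tens_relb_trans : transitive tens_relb.
Proof.
move=> t s r /asboolP h1 /asboolP h2; apply/asboolP; exact: tens_trans h1 h2.
Qed.

Canonical tens_equiv :=
  EquivRel tens_relb tens_relb_refl tens_relb_sym tens_relb_trans.

Definition tensor := {eq_quot tens_equiv}.
HB.instance Definition _ := Choice.on tensor.
HB.instance Definition _ := EqQuotient.on tensor.

Definition tclass s : tensor := \pi_tensor s.

Lemma tclassP s t : tens_rel s t -> tclass s = tclass t.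
Proof. by move=> h; apply/eqmodP/asboolP. Qed.

Lemma tclass_rel s t : tclass s = tclass t -> tens_rel s t.
Proof. by move/eqmodP/asboolP. Qed.

Lemma tclass_repr (x : tensor) : tclass (repr x) = x.
Proof. exact: reprK. Qed.

Lemma repr_tclass s : tens_rel (repr (tclass s)) s.
Proof. by apply: tclass_rel; rewrite tclass_repr. Qed.

Definition sscale (a : F) s := [seq (a *: p.1, p.2) | p <- s].

Lemma sscale_rel a s t : tens_rel s t -> tens_rel (sscale a s) (sscale a t).
Proof.
elim=> {s t} [s|s t _ ?|s t r _ h1 _ h2|s s' t t' _ h1 _ h2|s t|v|u u' v|u v v'|b u v].
- exact: tens_refl.
- exact: tens_sym.
- exact: tens_trans h1 h2.
- by rewrite /sscale !map_cat; exact: tens_cat.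
- by rewrite /sscale !map_cat; exact: tens_comm.
- by rewrite /= scaler0; exact: tens_zero.
- by rewrite /= scalerDr; exact: tens_addl.
- exact: tens_addr.
- by rewrite /= scalerA mulrC -scalerA; exact: tens_scale.
Qed.

Definition tens_add (x y : tensor) := tclass (repr x ++ repr y).
Definition tens_scalar (a : F) (x : tensor) := tclass (sscale a (repr x)).

Lemma tens_addE s t : tens_add (tclass s) (tclass t) = tclass (s ++ t).
Proof. by apply: tclassP; apply: tens_cat; exact: repr_tclass. Qed.

Lemma tens_scalarE a s : tens_scalar a (tclass s) = tclass (sscale a s).
Proof. by apply: tclassP; apply: sscale_rel; exact: repr_tclass. Qed.

Lemma sscale0_rel s : tens_rel (sscale 0 s) [::].
Proof.
elim: s => [|p s ih]; first exact: tens_refl.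
rewrite /= scale0r -cat1s -[X in tens_rel _ X]cats0.
by apply: tens_cat => //; exact: tens_zero.
Qed.

Lemma sscaleD_rel a b s :
  tens_rel (sscale (a + b) s) (sscale a s ++ sscale b s).
Proof.
elim: s => [|p s ih]; first exact: tens_refl.
rewrite /= scalerDl; set x := (a *: p.1, p.2); set y := (b *: p.1, p.2).
apply: (@tens_trans _ _ _ _ ([:: x; y] ++ (sscale a s ++ sscale b s))).
  exact: (@tens_cat _ _ _ [:: _] _ _ _ (tens_addl _ _ _) ih).
apply: (@tens_cat _ _ _ [:: x] _ _ _ (tens_refl _)).
rewrite -[y :: sscale b s]cat1s !catA.
exact: (tens_cat (tens_comm [:: y] (sscale a s)) (tens_refl _)).
Qed.

Fact tens_addA : associative tens_add.
Proof.
move=> x y z; rewrite -[x]tclass_repr -[y]tclass_repr -[z]tclass_repr.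
by rewrite !tens_addE catA.
Qed.

Fact tens_addC : commutative tens_add.
Proof. by move=> x y; apply: tclassP; exact: tens_comm. Qed.

Fact tens_add0 : left_id (tclass [::]) tens_add.
Proof. by move=> x; rewrite -[x]tclass_repr tens_addE. Qed.

Fact tens_addN : left_inverse (tclass [::]) (tens_scalar (-1)) tens_add.
Proof.
move=> x; rewrite -[x]tclass_repr tens_scalarE tens_addE; apply: tclassP.
set s := repr x; apply: tens_trans (sscale0_rel s).
rewrite -[0](addNr 1); apply: tens_sym; apply: tens_trans (sscaleD_rel _ _ _) _.
have -> : sscale 1 s = s.
  by rewrite /sscale -[RHS]map_id; apply: eq_map => -[u v] /=; rewrite scale1r.
exact: tens_refl.
Qed.

HB.instance Definition _ :=
  GRing.isZmodule.Build tensor tens_addA tens_addC tens_add0 tens_addN.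

Fact tens_scaleA a b (x : tensor) :
  tens_scalar a (tens_scalar b x) = tens_scalar (a * b) x.
Proof.
rewrite -[x]tclass_repr !tens_scalarE /sscale -map_comp; congr tclass.
by apply: eq_map => p /=; rewrite scalerA.
Qed.

Fact tens_scale1 : left_id 1 tens_scalar.
Proof.
move=> x; rewrite -[x]tclass_repr tens_scalarE; congr tclass.
by rewrite /sscale -[RHS]map_id; apply: eq_map => -[u v] /=; rewrite scale1r.
Qed.

Fact tens_scaleDr : right_distributive tens_scalar +%R.
Proof.
move=> a x y; rewrite -[x]tclass_repr -[y]tclass_repr.
rewrite [tclass _ + tclass _]tens_addE !tens_scalarE [RHS]tens_addE.
by rewrite /sscale map_cat.
Qed.

Fact tens_scaleDl x : {morph tens_scalar^~ x : a b / a + b}.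
Proof.
move=> a b /=; rewrite -[x]tclass_repr !tens_scalarE [RHS]tens_addE.
exact/tclassP/sscaleD_rel.
Qed.

HB.instance Definition _ := GRing.Zmodule_isLmodule.Build F tensor
  tens_scaleA tens_scale1 tens_scaleDr tens_scaleDl.

Definition tens (u : U) (v : V) : tensor := tclass [:: (u, v)].

End Tensor.

Notation "u *t v" := (tens u v) (at level 40, left associativity).

Section TensorTheory.
Context (F : fieldType) (U V : lmodType F).

Lemma tens_bilinear : bilinear_for *:%R *:%R (@tens F U V).
Proof.
have Zl a (u : U) (v : V) : (a *: u) *t v = a *: (u *t v).
  by rewrite [RHS]tens_scalarE.
split=> [v a u u'|u a v v'].
- by rewrite /= -Zl [RHS]tens_addE; exact/tclassP/tens_addl.
- rewrite /= -Zl [RHS]tens_addE; apply: tclassP.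
  apply: tens_trans (tens_addr _ _ _) _.
  exact: (tens_cat (tens_sym (tens_scale _ _ _)) (tens_refl [:: _])).
Qed.

Lemma tclass_sum (s : seq (U * V)) : tclass s = \sum_(p <- s) p.1 *t p.2.
Proof.
elim: s => [|p s ih]; first by rewrite big_nil.
by rewrite big_cons -ih [RHS]tens_addE; case: p.
Qed.

Lemma tensor_span (x : tensor U V) :
  exists s : seq (U * V), x = \sum_(p <- s) p.1 *t p.2.
Proof. by exists (repr x); rewrite -tclass_sum tclass_repr. Qed.

Context (W : lmodType F).

(* The linear map on the tensor product induced by b : U -> V -> W; only      *)
(* meaningful when b is bilinear, see tliftE and tlift_linear.                *)
Definition tlift (b : U -> V -> W) (x : tensor U V) : W :=
  \sum_(p <- repr x) b p.1 p.2.

Context (b : U -> V -> W).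
Hypothesis bil : bilinear_for *:%R *:%R b.

Lemma tlift_rel s t : tens_rel s t ->
  \sum_(p <- s) b p.1 p.2 = \sum_(p <- t) b p.1 p.2.
Proof.
have [bl br] := bil.
have b0 v : b 0 v = 0.
  by have := bl v 1 0 0; rewrite /= scale1r addr0 scale1r => /esym/eqP;
     rewrite -subr_eq0 addrK => /eqP.
have b0r u : b u 0 = 0.
  by have := br u 1 0 0; rewrite /= scale1r addr0 scale1r => /esym/eqP;
     rewrite -subr_eq0 addrK => /eqP.
elim=> {s t} [s|s t _ ->|s t r _ -> _ ->|s s' t t' _ h1 _ h2|s t|v|u u' v|u v v'|a u v] //.
- by rewrite !big_cat h1 h2.
- by rewrite !big_cat /= addrC.
- by rewrite big_seq1 big_nil b0.
- rewrite big_seq1 big_cons big_seq1 /=.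
  by have := bl v 1 u u'; rewrite /= !scale1r.
- rewrite big_seq1 big_cons big_seq1 /=.
  by have := br u 1 v v'; rewrite /= !scale1r.
- rewrite !big_seq1 /=; have := bl v a u 0; have := br u a v 0.
  by rewrite /= !addr0 b0 b0r !addr0 => -> ->.
Qed.

Lemma tliftE u v : tlift b (u *t v) = b u v.
Proof. by rewrite /tlift (tlift_rel (repr_tclass _)) big_seq1. Qed.

Lemma tlift_linear : linear (tlift b).
Proof.
move=> a x y; rewrite -[x]tclass_repr -[y]tclass_repr /tlift.
rewrite [a *: _]tens_scalarE [X in repr X]tens_addE.
rewrite !(tlift_rel (repr_tclass _)) big_cat /= big_map scaler_sumr /=.
congr (_ + _); apply: eq_bigr => p _.
have [bl br] := bil; have := bl p.2 a p.1 0; have := bl p.2 1 0 0.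
rewrite /= scale1r addr0 scale1r => /esym/eqP.
by rewrite -subr_eq0 addrK => /eqP ->; rewrite !addr0.
Qed.

End TensorTheory.

Section TensorMaps.
Context (F : fieldType).

Definition tmap (U V U' V' : lmodType F) (f : U -> U') (g : V -> V') :
  tensor U V -> tensor U' V' := tlift (fun u v => f u *t g v).

Definition tflip (U V : lmodType F) : tensor U V -> tensor V U :=
  tlift (fun u v => v *t u).

Definition tassoc (U V W : lmodType F) :
    tensor U (tensor V W) -> tensor (tensor U V) W :=
  tlift (fun u => tlift (fun v w => (u *t v) *t w)).

Lemma tmap_bilinear (U V U' V' : lmodType F)
    (f : {linear U -> U'}) (g : {linear V -> V'}) :
  bilinear_for *:%R *:%R (fun u v => f u *t g v).
Proof.
have [bl br] := tens_bilinear U' V'; split=> [v a u u'|u a v v'] /=.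
- by rewrite linearP; exact: bl.
- by rewrite linearP; exact: br.
Qed.

Lemma tmapE (U V U' V' : lmodType F)
    (f : {linear U -> U'}) (g : {linear V -> V'}) u v :
  tmap f g (u *t v) = f u *t g v.
Proof. exact/tliftE/tmap_bilinear. Qed.

Lemma tmap_linear (U V U' V' : lmodType F)
  (f : {linear U -> U'}) (g : {linear V -> V'}) : linear (tmap f g).
Proof. exact/tlift_linear/tmap_bilinear. Qed.

Lemma tflip_bilinear (U V : lmodType F) :
  bilinear_for *:%R *:%R (fun (u : U) (v : V) => v *t u).
Proof. by have [bl br] := tens_bilinear V U; split. Qed.

Lemma tflipE (U V : lmodType F) (u : U) (v : V) : tflip (u *t v) = v *t u.
Proof. exact/tliftE/tflip_bilinear. Qed.

Lemma tflip_linear (U V : lmodType F) : linear (@tflip U V).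
Proof. exact/tlift_linear/tflip_bilinear. Qed.

Lemma tassoc_bilinear1 (U V W : lmodType F) (u : U) :
  bilinear_for *:%R *:%R (fun (v : V) (w : W) => (u *t v) *t w).
Proof.
have [bl br] := tens_bilinear (tensor U V) W.
have [_ br'] := tens_bilinear U V.
split=> [w a v v'|v a w w'] /=; last exact: br.
by rewrite (br' u a v v'); exact: bl.
Qed.

Lemma tassoc_bilinear (U V W : lmodType F) :
  bilinear_for *:%R *:%R
    (fun u : U => tlift (fun (v : V) (w : W) => (u *t v) *t w)).
Proof.
have [bl _] := tens_bilinear (tensor U V) W.
have [bl' _] := tens_bilinear U V.
split=> [x a u u'|u] /=; last exact/tlift_linear/tassoc_bilinear1.
rewrite /tlift scaler_sumr -big_split /=; apply: eq_bigr => p _.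
by rewrite (bl' p.1 a u u'); exact: bl.
Qed.

Lemma tassocE (U V W : lmodType F) (u : U) (v : V) (w : W) :
  tassoc (u *t (v *t w)) = (u *t v) *t w.
Proof.
rewrite /tassoc (tliftE (tassoc_bilinear U V W)).
exact/tliftE/tassoc_bilinear1.
Qed.

Lemma tassoc_linear (U V W : lmodType F) : linear (@tassoc U V W).
Proof. exact/tlift_linear/tassoc_bilinear. Qed.

Context (V : lmodType F).

(* c (x) Id and Id (x) c, followed by the identification of F (x) V and       *)
(* V (x) F with V                                                             *)
Definition ctensl (c : V -> F) : tensor V V -> V := tlift (fun u v => c u *: v).
Definition ctensr (c : V -> F) : tensor V V -> V := tlift (fun u v => c v *: u).

End TensorMaps.

(* * Gradings                                                                 *)

Section Gradings.
Context (F : fieldType).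

Definition is_subspace (W : lmodType F) (S : set W) :=
  S 0 /\ forall a x y, S x -> S y -> S (a *: x + y).

(* W is the internal direct sum of the subspaces G k *)
Definition is_grading (W : lmodType F) (G : int -> set W) :=
  (forall k, is_subspace (G k)) /\
  (forall w, exists! w_ : int -> W,
     [/\ forall k, G k (w_ k), finite_set [set k | w_ k != 0] &
         w = \sum_(k \in [set: int]) w_ k]).

Definition tens_grading (U V : lmodType F)
    (G : int -> set U) (H : int -> set V) : int -> set (tensor U V) :=
  fun n => [set x | exists s : seq (U * V), x = \sum_(p <- s) p.1 *t p.2 /\
    forall p, p \in s -> exists i j, [/\ i + j = n, G i p.1 & H j p.2]].

(* A family of functionals on the W_(k), all but finitely many zero, is the   *)
(* same as a functional on W vanishing on all but finitely many W_(k).        *)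
Definition in_graded_dual (W : lmodType F) (G : int -> set W)
    (f : {scalar W}) : Prop :=
  finite_set [set k : int | exists2 w, G k w & f w != 0].

End Gradings.

(* * Formal series                                                            *)

(* A doubly infinite formal series in several variables, with coefficients    *)
(* in W, is a function E -> W on the group E of exponents: E = int,           *)
(* int * int or int * int * int.                                              *)

Section Series.
Context (F : fieldType).

Definition smul (E : zmodType) (W : lmodType F) (f : E -> F) (g : E -> W) :
  E -> W := fun e => \sum_(i \in [set: E]) f i *: g (e - i).

Definition gbinom (n : int) (i : nat) : F :=
  (\prod_(j < i) (n - j%:Z)%:~R) / i`!%:R.

(* coefficient of y^p z^q in (y + a z)^n, expanded in nonnegative powers of z *)
Definition binom_series (a : F) (n : int) (e : int * int) : F :=
  let: (p, q) := e in
  match q with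
  | Posz i => if p + q == n then gbinom n i * a ^+ i else 0
  | Negz _ => 0
  end.

(* coefficient of x^p y^q z^r in x^-1 delta((y - z) / (a x)), that is, in     *)
(* \sum_(n : int) a^-n x^(-n-1) (y - z)^n                                     *)
Definition delta_series (a : F) (p q r : int) : F :=
  a ^ (p + 1) * binom_series (-1) (- p - 1) (q, r).

End Series.

(* * Vertex coalgebras                                                        *)

Section VertexCoalgebra.
Context (F : fieldType) (V : lmodType F) (G : int -> set V).
(* Y n is the coefficient of x^n in Y(x), so that Delta_k is Y (- k - 1)      *)
Context (Y : int -> {linear V -> tensor V V}) (c : {scalar V}).

Notation V3 := (tensor (tensor V V) V).

Record vertex_coalgebra_sans_jacobi : Prop := {
  vc_grading : is_grading G;
  vc_lower : exists N : int, forall k, k < N -> G k = [set 0];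
  vc_weight : forall (r k : int) v, G r v ->
    tens_grading G G (r + k + 1) (Y (- k - 1) v);
  vc_counit : forall v n, ctensl c (Y n v) = if n == 0 then v else 0;
  vc_cocreation : forall v, (forall n, n < 0 -> ctensr c (Y n v) = 0) /\
    ctensr c (Y 0 v) = v;
  vc_truncation : forall v, exists N : int, forall n, N < n -> Y n v = 0
}.

Definition Dstar (v : V) : V := ctensr c (Y 1 v).

(* Y(x) (x) Id and Id (x) Y(x), coefficient of x^n *)
Definition YId (n : int) : tensor V V -> V3 := tmap (Y n) idfun.
Definition IdY (n : int) : tensor V V -> V3 := @tassoc F V V V \o tmap idfun (Y n).

(* (Y(x0) (x) Id) Y(x2) v, in the variables (x0, x2) *)
Definition YId_Y (v : V) : int * int -> V3 := fun '(p, q) => YId p (Y q v).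

(* Y(x0 + x2) v, in the variables (x0, x2) *)
Definition Y_sum (v : V) : int * int -> tensor V V :=
  fun e => \sum_(n \in [set: int]) binom_series 1 n e *: Y n v.

(* (Id (x) Y(x2)) Y(x0 + x2) v, in the variables (x0, x2) *)
Definition IdY_Y_sum (v : V) : int * int -> V3 :=
  fun '(p, q) => \sum_(j \in [set: int]) IdY (q - j) (Y_sum v (p, j)).

Definition weak_coassociativity : Prop :=
  forall f : {scalar V3}, in_graded_dual (tens_grading (tens_grading G G) G) f ->
  exists k : nat, (0 < k)%N /\ forall v,
    smul (W := F^o) (binom_series 1 k%:Z)
      (fun e => f (YId_Y v e - IdY_Y_sum v e)) = fun=> 0.

(* the summand of index n in the coefficient of x^m in Y(-x) e^(x D* ) v      *)
Definition YexpD (v : V) (m : int) (n : nat) : tensor V V :=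
  (-1) ^ (m - n%:Z) *: Y (m - n%:Z) ((n`!%:R)^-1 *: iter n Dstar v).

(* The identity includes the existence of its right-hand side, i.e. that the  *)
(* sum defining each coefficient is finite (an infinite \sum_(_ \in _) is 0). *)
Definition skew_symmetry : Prop := forall v m,
  finite_set [set n | YexpD v m n != 0] /\
  @tflip F V V (Y m v) = \sum_(n \in [set: nat]) YexpD v m n.

(* Three-variable series, in the variables (x0, x1, x2):                      *)
(* (Id (x) Y(x2)) Y(x1) v,  (T (x) Id) (Id (x) Y(x1)) Y(x2) v  and            *)
(* (Y(x0) (x) Id) Y(x2) v                                                     *)
Definition IdY2_Y1 (v : V) : int * int * int -> V3 :=
  fun '(p, q, r) => if p == 0 then IdY r (Y q v) else 0.
Definition T_IdY1_Y2 (v : V) : int * int * int -> V3 :=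
  fun '(p, q, r) =>
    if p == 0 then tmap (@tflip F V V) idfun (IdY q (Y r v)) else 0.
Definition Y0Id_Y2 (v : V) : int * int * int -> V3 :=
  fun '(p, q, r) => if q == 0 then YId p (Y r v) else 0.

(* x0^-1 delta((x1 - x2)/x0), x0^-1 delta((x2 - x1)/(-x0)) and                *)
(* x2^-1 delta((x1 - x0)/x2), in the variables (x0, x1, x2)                   *)
Definition delta_12_0 : int * int * int -> F :=
  fun '(p, q, r) => delta_series 1 p q r.
Definition delta_21_0 : int * int * int -> F :=
  fun '(p, q, r) => delta_series (-1) p r q.
Definition delta_10_2 : int * int * int -> F :=
  fun '(p, q, r) => delta_series 1 r q p.

Definition jacobi_identity : Prop := forall v,
  (fun e => smul delta_12_0 (IdY2_Y1 v) e - smul delta_21_0 (T_IdY1_Y2 v) e) =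
  smul delta_10_2 (Y0Id_Y2 v).

(* The truncation axiom makes all the sums above, except for that of          *)
(* skew_symmetry, finite.                                                     *)

Let linear0' (W W' : lmodType F) (f : W -> W') : linear f -> f 0 = 0.
Proof.
by move=> fl; have := fl (-1) 0 0; rewrite scaleN1r oppr0 addr0 scaleN1r addNr.
Qed.

Let YId0 n : YId n 0 = 0. Proof. exact/linear0'/tmap_linear. Qed.

Let IdY0 n : IdY n 0 = 0.
Proof. by rewrite /IdY /= (linear0' (@tmap_linear _ _ _ _ _ idfun (Y n)))
  (linear0' (@tassoc_linear _ V V V)). Qed.

Let T0 : tmap (@tflip F V V) (@idfun V) 0 = 0.
Proof.
pose t := GRing.isLinear.Build F _ _ _ _ (@tflip_linear F V V).
pose T : {linear tensor V V -> tensor V V} := HB.pack (@tflip F V V) t.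
exact: (linear0' (@tmap_linear _ _ _ _ _ T idfun)).
Qed.

Let binom_supp (a : F) n p q : binom_series a n (p, q) != 0 ->
  exists2 i : nat, q = i & p = n - i%:Z.
Proof.
rewrite /binom_series; case: q => [i|i]; last by rewrite eqxx.
by case: (_ + _ =P _) => [<- _|_]; [exists i => //; rewrite addrK | rewrite eqxx].
Qed.

Let finite_nat_image (T : Type) (h : nat -> T) (P : set T) (m : int) :
  (forall x, P x -> exists2 i : nat, x = h i & i%:Z <= m) -> finite_set P.
Proof.
move=> hP; apply: (@sub_finite_set _ _ (h @` `I_(`|m|%N.+1))); last first.
  exact/finite_image/finite_II.
move=> x /hP[i -> le_im]; exists i => //=; rewrite ltnS.
by rewrite -lez_nat (le_trans le_im)// abszE ler_norm.
Qed.

Hypothesis trunc : forall v, exists N : int, forall n, N < n -> Y n v = 0.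

Lemma Y_sum_finite v e :
  finite_set [set n : int | binom_series 1 n e *: Y n v != 0].
Proof.
case: e => p q; apply: (@sub_finite_set _ _ [set p + q]) => // n.
rewrite /mkset => h.
have /binom_supp[i -> ->] : binom_series (1 : F) n (p, q) != 0.
  by apply: contraNneq h => ->; rewrite scale0r.
by rewrite subrK.
Qed.

Lemma IdY_Y_sum_finite v p q :
  finite_set [set j : int | IdY (q - j) (Y_sum v (p, j)) != 0].
Proof.
have [N hN] := trunc v.
apply: (@finite_nat_image _ Posz _ (N - p)) => j /= h.
have : Y_sum v (p, j) != 0 by apply: contraNneq h => ->; rewrite IdY0.
rewrite /Y_sum => h1.
have [n hn] : exists n : int, binom_series 1 n (p, j) *: Y n v != 0.
  apply: contrapT => hall; move: h1; rewrite fsbig1 ?eqxx// => n _.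
  by apply: contrapT => /eqP hn; apply: hall; exists n.
have /binom_supp[i jE pE] : binom_series (1 : F) n (p, j) != 0.
  by apply: contraNneq hn => ->; rewrite scale0r.
exists i => //; have : ~~ (N < n).
  by apply: contraNN hn => /hN ->; rewrite scaler0.
by rewrite pE -leNgt => ?; lia.
Qed.

Lemma jacobi_finite1 v e :
  finite_set [set i | delta_12_0 i *: IdY2_Y1 v (e - i) != 0].
Proof.
have [N hN] := trunc v; case: e => [[p q] r].
apply: (@finite_nat_image _ (fun i : nat => (p, - p - 1 - i%:Z, i%:Z)) _
  (N - q - p - 1)) => -[[a b] d] /=.
rewrite scaler_eq0 negb_or mulf_eq0 negb_or => /andP[/andP[_ /binom_supp]].
move=> [i -> bE]; case: (_ - a =P 0) => [/subr0_eq aE|_]; rewrite ?eqxx// => h.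
exists i; first by congr (_, _, _); lia.
have : ~~ (N < q - b) by apply: contraNN h => /hN ->; rewrite IdY0.
by rewrite bE -leNgt => ?; lia.
Qed.

Lemma jacobi_finite2 v e :
  finite_set [set i | delta_21_0 i *: T_IdY1_Y2 v (e - i) != 0].
Proof.
have [N hN] := trunc v; case: e => [[p q] r].
apply: (@finite_nat_image _ (fun i : nat => (p, i%:Z, - p - 1 - i%:Z)) _
  (N - r - p - 1)) => -[[a b] d] /=.
rewrite scaler_eq0 negb_or mulf_eq0 negb_or => /andP[/andP[_ /binom_supp]].
move=> [i -> dE]; case: (_ - a =P 0) => [/subr0_eq aE|_]; rewrite ?eqxx// => h.
exists i; first by congr (_, _, _); lia.
have : ~~ (N < r - d) by apply: contraNN h => /hN ->; rewrite IdY0 T0.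
by rewrite dE -leNgt => ?; lia.
Qed.

Lemma jacobi_finite3 v e :
  finite_set [set i | delta_10_2 i *: Y0Id_Y2 v (e - i) != 0].
Proof.
have [N hN] := trunc v; case: e => [[p q] r].
apply: (@finite_nat_image _ (fun i : nat => (i%:Z, q, - q - 1 - i%:Z)) _
  (N - r - q - 1)) => -[[a b] d] /=.
rewrite scaler_eq0 negb_or mulf_eq0 negb_or => /andP[/andP[_ /binom_supp]].
move=> [i -> bE]; case: (_ - b =P 0) => [/subr0_eq qE|_]; rewrite ?eqxx// => h.
exists i; first by congr (_, _, _); lia.
have : ~~ (N < r - d) by apply: contraNN h => /hN ->; rewrite YId0.
by rewrite -leNgt => ?; lia.
Qed.

End VertexCoalgebra.

(* Main.v *)
From HB Require Import structures.
Require Import Defs.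
From mathcomp Require Import all_boot all_order all_algebra.
From mathcomp Require Import all_classical.
From mathcomp Require Import zify ring.
Import Order.TTheory GRing.Theory Num.Theory.
Local Open Scope classical_set_scope.
Local Open Scope ring_scope.

Set Implicit Arguments.
Unset Strict Implicit.
Unset Printing Implicit Defensive.

(** Pair both sides of the identity with the functionals g1 (x) g2 (x) g3 whose
    factors are homogeneous functionals on V; they separate the points of the
    triple tensor product ([homog_separates], [tpair_separates]). Transposing
    the coefficients of Y turns functionals g, h into functionals
    [dualY n g h], so that the graded dual of V carries products which vanish
    for small n ([dualY_trunc]). In these terms weak coassociativity is weak
    associativity ([dualY_weak_assoc]), and the claim is dual to the fact that
    a weakly associative, skew-symmetric product is a vertex algebra.

    Fix v and let J(x0, x1, x2), with coefficients j(p, q, r), be the difference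
    of the two paired sides. Every delta function in it is killed by
    x1 - x2 - x0, which is the Pascal-like relation
      j(p, q-1, r) = j(p, q, r-1) + j(p-1, q, r)          ([delta_rel]).
    The second delta term has no small powers of x1. For the rest, the section
    q = -1 is the difference between the two sides of weak associativity, and
    by the relation passing from q to q-1 multiplies a section by x0 + x2.
    Hence j vanishes for q small ([jacobi_defect_low]).
    Skew-symmetry gives J(x0, x1, x2) = J'(-x0, x2, x1), where J' is built from
    g2, g1, g3 ([jacobi_defect_swap]), so that j vanishes for r small too.
    Applied n times, the relation writes j(p, q, r) as a combination of the
    j(p+n, q-i, r-n+i) with i <= n; for n large each of them has its second or
    its third index in the vanishing range, and J = 0
    ([delta_rel_vanish], [jacobi_defect_eq0]).

    For the exchange of g1 and g2, the operator e^(x D* ) of skew-symmetry has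
    to act on the first factor of Y as a translation of x. This is
    [dualY_deriv]: it is weak coassociativity paired with g (x) c (x) h, which
    can be used because c turns out to be homogeneous of degree 0
    ([counit_homog]). *)

(** * Finitely supported sums *)

Lemma fsum_seq (W : zmodType) (E : choiceType) (u : E -> W) (r : seq E) :
  uniq r -> (forall e, u e != 0 -> e \in r) ->
  \sum_(e \in [set: E]) u e = \sum_(e <- r) u e.
Proof.
move=> ur hr; rewrite (fsbigE r) //; last first.
  by move=> e _; apply: contraNeq; exact: hr.
by apply: eq_bigl => e; rewrite in_setT.
Qed.

Lemma fsum_nat (W : zmodType) (E : choiceType) (h : nat -> E) (n : nat)
    (u : E -> W) :
  injective h -> (forall e, u e != 0 -> exists2 i, (i < n)%N & e = h i) ->
  \sum_(e \in [set: E]) u e = \sum_(i < n) u (h i).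
Proof.
move=> hI hu; rewrite (@fsum_seq _ _ _ [seq h i | i <- iota 0 n]).
- by rewrite big_map -[X in iota _ X]subn0 -/(index_iota 0 n) big_mkord.
- by rewrite map_inj_uniq ?iota_uniq.
- by move=> e /hu[i lt_in ->]; rewrite mem_map // mem_iota.
Qed.

Lemma finite_supp_seq (W : zmodType) (E : choiceType) (u : E -> W) :
  finite_set [set e | u e != 0] ->
  exists2 r : seq E, uniq r & forall e, u e != 0 -> e \in r.
Proof.
move=> /finite_seqP[r rE]; exists (undup r); first exact: undup_uniq.
by move=> e; rewrite mem_undup => ue; have : [set e | u e != 0] e by []; rewrite rE.
Qed.

Lemma morph_fsum (W W' : zmodType) (f : W -> W') (E : choiceType)
    (u : E -> W) : {morph f : x y / x + y} -> f 0 = 0 ->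
  finite_set [set e | u e != 0] ->
  f (\sum_(e \in [set: E]) u e) = \sum_(e \in [set: E]) f (u e).
Proof.
move=> fD f0 /finite_supp_seq[r ur hr].
rewrite (fsum_seq ur hr) (big_morph f fD f0).
rewrite (fsum_seq ur) // => e; apply: contraNT => er; apply/eqP.
have [->|/hr] := eqVneq (u e) 0; first exact: f0.
by rewrite (negPf er).
Qed.

(** * Binomial coefficients with an integer upper index *)

Section GeneralizedBinomial.
Context (F : fieldType) (charF0 : [pchar F] =i pred0).
Local Notation gb := (gbinom F).

Let natF0 (n : nat) : (n.+1%:R : F) != 0.
Proof. by rewrite (iffLR (pcharf0P F) charF0). Qed.

Lemma gbinom0 n : gb n 0 = 1.
Proof. by rewrite /gbinom big_ord0 fact0 divr1. Qed.

Lemma gbinomS n i : gb n i.+1 = (n - i%:Z)%:~R / i.+1%:R * gb n i.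
Proof.
rewrite /gbinom big_ord_recr /= factS natrM invfM.
by move: (i.+1%:R^-1) (i`!%:R^-1) => x y; ring.
Qed.

Lemma gbinomSS n i : gb (n + 1) i.+1 = (n + 1)%:~R / i.+1%:R * gb n i.
Proof.
rewrite /gbinom big_ord_recl /= subr0 factS natrM invfM.
under eq_bigr => j _.
  have -> : n + 1 - (lift ord0 j : nat)%:Z = n - j%:Z.
    by rewrite /lift /= /bump leq0n; lia.
  over.
by move: (i.+1%:R^-1) (i`!%:R^-1) => x y; ring.
Qed.

Lemma gbinom_pascal n i : gb (n + 1) i.+1 = gb n i.+1 + gb n i.
Proof.
rewrite gbinomSS gbinomS -[X in _ = _ + X]mul1r -mulrDl; congr (_ * _).
have e : (n + 1)%:~R = (n - i%:Z)%:~R + i.+1%:R :> F.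
  by rewrite -[i.+1%:R]/((i.+1%:Z)%:~R) -intrD; congr _%:~R; lia.
by rewrite e mulrDl divff.
Qed.

(** This rewrites the signed coefficients of the delta functions as
    the coefficients of (x0 + x2)^(p + i), which obey Pascal's rule along the
    diagonal, see [gbinom_diag_pascal]. *)
Lemma gbinom_neg p i : gb (- p - 1) i * (-1) ^+ i = gb (p + i%:Z) i.
Proof.
elim: i => [|i ih]; first by rewrite !gbinom0 mulr1.
have -> : p + i.+1%:Z = p + i%:Z + 1 by lia.
rewrite gbinomSS -ih gbinomS exprS.
have -> : (- p - 1 - i%:Z)%:~R = - (p + i%:Z + 1)%:~R :> F.
  by rewrite -intrN; congr _%:~R; lia.
by ring.
Qed.

Lemma gbinom_nat (m i : nat) : gb m%:Z i = 'C(m, i)%:R.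
Proof.
elim: m i => [|m ih] [|i]; rewrite ?gbinom0 ?bin0 //.
  by elim: i => [|i ihi]; rewrite gbinomS ?ihi ?mulr0 // subr0 !mul0r.
have -> : m.+1%:Z = m%:Z + 1 by lia.
by rewrite gbinom_pascal !ih binS natrD.
Qed.

Lemma gbinom_diag_pascal (p : int) (i : nat) :
  gb (p + i.+1%:Z) i.+1 = gb (p - 1 + i.+1%:Z) i.+1 + gb (p + i%:Z) i.
Proof.
have -> : p + i.+1%:Z = p + i%:Z + 1 by lia.
by rewrite gbinom_pascal; congr (gb _ _ + _); lia.
Qed.

End GeneralizedBinomial.

(** * Series in two variables *)

Section Series.
Context (F : fieldType) (charF0 : [pchar F] =i pred0).
Local Notation gb := (gbinom F).

(** Multiplication of a series in x, y by x + y. *)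
Definition mulXY (h : int * int -> F) (e : int * int) : F :=
  h (e.1 - 1, e.2) + h (e.1, e.2 - 1).

Lemma iter_mulXYE k h p s : iter k mulXY h (p, s) =
  \sum_(i < k.+1) 'C(k, i)%:R * h (p - k%:Z + i%:Z, s - i%:Z).
Proof.
elim: k p s => [|k ih] p s.
  by rewrite big_ord_recl big_ord0 bin0 mul1r !subr0 !addr0.
rewrite iterS /mulXY /= !ih [RHS]big_ord_recl /=.
rewrite [X in _ = _ + X](eq_bigr (fun i : 'I_k.+1 =>
  'C(k, i.+1)%:R * h (p - 1 - k%:Z + i.+1%:Z, s - i.+1%:Z)
   + 'C(k, i)%:R * h (p - k%:Z + i%:Z, s - 1 - i%:Z))); last first.
  move=> i _; rewrite /lift /= /bump leq0n binS natrD mulrDl.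
  by congr (_ * h (_, _) + _ * h (_, _)); lia.
rewrite big_split /= addrA; congr (_ + _).
rewrite [X in _ = _ + X]big_ord_recr /= (@bin_small k k.+1) // mul0r addr0.
rewrite [LHS]big_ord_recl /= !bin0.
congr (_ * h (_, _) + _); first lia.
by rewrite addr0; apply: eq_bigr => i _; rewrite /bump leq0n.
Qed.

Lemma smul_binom_mulXY k (h : int * int -> F) e :
  smul (W := F^o) (binom_series 1 k%:Z) h e = iter k mulXY h e.
Proof.
case: e => p s; rewrite iter_mulXYE /smul.
rewrite (@fsum_nat _ _ (fun i : nat => (k%:Z - i%:Z, i%:Z)) k.+1).
- apply: eq_bigr => i _.
  rewrite /binom_series subrK eqxx expr1n mulr1 gbinom_nat //.
  congr (_ * h _); rewrite -[(p, s) - _]/(p - (k%:Z - i%:Z), s - i%:Z).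
  by congr (_, _); lia.
- by move=> i j [_].
- case=> a [b|b]; rewrite /binom_series ?scale0r ?eqxx //.
  case: (_ + _ =P _) => [e|_]; rewrite ?scale0r ?eqxx // expr1n mulr1 gbinom_nat //.
  case: (ltnP b k.+1) => [lt_bk _|lt_kb]; last by rewrite bin_small // scale0r eqxx.
  by exists b => //; congr pair; lia.
Qed.

(** On series with exponents of x bounded below, x + y can be cancelled: at
    the least exponent of x the product is y times the series. *)
Lemma mulXY_inj (h : int * int -> F) (P0 : int) k :
  (forall p s, p < P0 -> h (p, s) = 0) ->
  (forall e, iter k mulXY h e = 0) -> forall e, h e = 0.
Proof.
move=> hP; elim: k => [//|k ih] h0; apply: ih.
set g := iter k mulXY h in h0 * => e.
have gP p s : p < P0 -> g (p, s) = 0.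
  rewrite /g; elim: k {h0 g} p s => [|k ih] p s lt; first exact: hP.
  by rewrite iterS /mulXY /= !ih ?addr0 //; lia.
have gn (n : nat) s : g (P0 - 1 + n%:Z, s) = 0.
  elim: n s => [|n ih] s; first by rewrite gP //; lia.
  have := h0 (P0 - 1 + n.+1%:Z, s + 1); rewrite iterS -/g /mulXY /= addrK.
  have -> : P0 - 1 + n.+1%:Z - 1 = P0 - 1 + n%:Z by lia.
  by rewrite ih add0r.
case: e => p s; have [/gP->//|le] := ltP p P0.
by have <- : P0 - 1 + (`|(p - P0 + 1)%R|%N)%:Z = p by lia.
Qed.

Lemma iter_mulXYB k (g h : int * int -> F) e :
  iter k mulXY (fun e => g e - h e) e = iter k mulXY g e - iter k mulXY h e.
Proof.
case: e => p s; rewrite !iter_mulXYE -sumrB.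
by apply: eq_bigr => i _; rewrite mulrBr.
Qed.

Section DeltaSum.
Context (M : int) (a : int -> int -> F).
Context (aM : forall s t, M < s -> a s t = 0).

(** The coefficient of x0^p x1^q x2^r in x0^-1 delta((x1 - x2)/x0) a(x1, x2),
    after [gbinom_neg]. The exponents of x1 in a are at most M, so the terms
    beyond the displayed range vanish. For q = -1 it is the coefficient of
    x0^p x2^r in a(x0 + x2, x2). *)
Definition delta_sum (p q r : int) : F :=
  \sum_(i < `|(M - (p + q))%R|%N)
     gb (p + i%:Z) i * a (p + q + 1 + i%:Z) (r - i%:Z).

Lemma delta_sum_widen n p q r : M - (p + q) <= n%:Z ->
  \sum_(i < n) gb (p + i%:Z) i * a (p + q + 1 + i%:Z) (r - i%:Z) =
  delta_sum p q r.
Proof.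
have w m1 m2 : (m1 <= m2)%N -> M - (p + q) <= m1%:Z ->
  \sum_(i < m2) gb (p + i%:Z) i * a (p + q + 1 + i%:Z) (r - i%:Z) =
  \sum_(i < m1) gb (p + i%:Z) i * a (p + q + 1 + i%:Z) (r - i%:Z).
  move=> le le1; rewrite (big_ord_widen m2
    (fun i => gb (p + i%:Z) i * a (p + q + 1 + i%:Z) (r - i%:Z)) le).
  rewrite [RHS]big_mkcond; apply: eq_bigr => i _; case: ltnP => // le2.
  by rewrite aM ?mulr0 //; lia.
move=> le; rewrite /delta_sum; have [l|l] := leqP n `|(M - (p + q))%R|%N.
  by rewrite [RHS](w n).
by rewrite (w `|(M - (p + q))%R|%N) //; lia.
Qed.

(** The delta function is killed by x1 - x2 - x0. *)
Lemma delta_sum_rel p q r :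
  delta_sum p (q - 1) r = delta_sum p q (r - 1) + delta_sum (p - 1) q r.
Proof.
pose n := (`|(M - (p + q))%R|%N.+2).
rewrite -(@delta_sum_widen n.+1 p (q - 1)); last by rewrite /n; lia.
rewrite -(@delta_sum_widen n.+1 (p - 1)); last by rewrite /n; lia.
rewrite -(@delta_sum_widen n p q); last by rewrite /n; lia.
rewrite big_ord_recl [X in _ = _ + X]big_ord_recl !gbinom0.
rewrite [RHS]addrCA; congr (_ + _).
  by congr (_ * a _ _); lia.
rewrite -big_split; apply: eq_bigr => i _ /=.
rewrite /lift /= /bump leq0n /= add1n gbinom_diag_pascal // mulrDl addrC.
by congr (_ * a _ _ + _ * a _ _); lia.
Qed.

(** The residue in x0 of the delta function is 1. *)
Lemma delta_sum_res q r : delta_sum (-1) q r = a q r.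
Proof.
rewrite -(@delta_sum_widen (`|(M - (-1 + q))%R|%N.+1)); last lia.
rewrite big_ord_recl big1 ?addr0 => [|i _].
  by rewrite gbinom0 mul1r; congr a; lia.
rewrite /lift /= /bump leq0n add1n.
have -> : -1 + i.+1%:Z = i%:Z by lia.
by rewrite gbinom_nat // bin_small // mul0r.
Qed.

End DeltaSum.

(** The coefficient of x^p y^s in the expansion of (x + y)^(p + s) in
    nonnegative powers of y; exchanging p and s gives the expansion in
    nonnegative powers of x. *)
Definition pascal (p s : int) : F :=
  if s is Posz i then gb (p + s) i else 0.

Lemma pascalD p s : pascal p s = pascal (p - 1) s + pascal p (s - 1).
Proof.
rewrite /pascal; case: s => [[|i]|i].
- by rewrite !gbinom0 addr0.
- have -> : i.+1%:Z - 1 = i%:Z by lia.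
  by rewrite gbinom_diag_pascal.
- have -> : Negz i - 1 = Negz i.+1 by lia.
  by rewrite addr0.
Qed.

(** The two expansions of (x + y)^n agree for n >= 0, where both are the
    binomial formula. *)
Lemma pascal_sym p s : 0 <= p + s -> pascal p s = pascal s p.
Proof.
move=> le0; wlog: p s le0 / exists i : nat, s = i%:Z.
  move=> wl; case: s le0 => [i|i] le0; first by apply: wl => //; exists i.
  case: p le0 => [j|j] le0; last by move: le0; lia.
  by apply/esym/wl; [rewrite addrC | exists j].
move=> [i sE]; move: le0; rewrite sE /pascal => le0.
case: p le0 => [j|j] le0.
  by rewrite -!PoszD !gbinom_nat // (addnC i j) -(bin_sub (leq_addr i j)) addKn.
have -> : Negz j + i%:Z = (`|(Negz j + i%:Z)%R|%N)%:Z by lia.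
by rewrite gbinom_nat // bin_small //; lia.
Qed.

(** Multiplication by (x + y)^k carries the difference of the two expansions of
    (x + y)^n to the one for n + k, which is zero once n + k >= 0. *)
Lemma iter_mulXY_pascal (a : int -> F) k p s :
  iter k mulXY (fun e => a (e.1 + e.2) * (pascal e.2 e.1 - pascal e.1 e.2))
    (p, s) = a (p + s - k%:Z) * (pascal s p - pascal p s).
Proof.
elim: k p s => [|k ih] p s; first by rewrite subr0.
rewrite iterS /mulXY /= !ih (pascalD p s) (pascalD s p).
have -> : p - 1 + s - k%:Z = p + s - k.+1%:Z by lia.
have -> : p + (s - 1) - k%:Z = p + s - k.+1%:Z by lia.
ring.
Qed.

End Series.

(** * Series killed by x1 - x2 - x0 *)

Section Signs.
Context (F : fieldType).

Lemma signzD1 (p : int) : (-1) ^ (p + 1) = - (-1) ^ p :> F.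
Proof. by rewrite expfzDr ?oppr_eq0 ?oner_eq0 // expr1z mulrN1. Qed.

Lemma signzB1 (p : int) : (-1) ^ (p - 1) = - (-1) ^ p :> F.
Proof. by rewrite -[X in - (_ ^ X)](subrK 1) signzD1 opprK. Qed.

Lemma signz_sqr (p : int) : (-1) ^ p * (-1) ^ p = 1 :> F.
Proof. by rewrite -expfzMl mulrNN mulr1 exp1rz. Qed.

Lemma signzBn (p : int) (i : nat) :
  (-1) ^ p * (-1) ^ (p - i%:Z) = (-1) ^+ i :> F.
Proof.
elim: i => [|i ih]; first by rewrite subr0 signz_sqr.
have -> : p - i.+1%:Z = p - i%:Z - 1 by lia.
by rewrite signzB1 mulrN ih exprS mulN1r.
Qed.

End Signs.

Section Jacobi.
Context (F : fieldType) (charF0 : [pchar F] =i pred0).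

(** The coefficients of a series killed by x1 - x2 - x0. *)
Definition delta_rel (u : int -> int -> int -> F) :=
  forall p q r, u p (q - 1) r = u p q (r - 1) + u (p - 1) q r.

(** The section at q = -1 - k is the coefficient of x1^-1 in x1^k u, and
    x1 acts on u as x0 + x2. *)
Lemma delta_rel_iter u : delta_rel u -> forall k p r,
  u p (-1 - k%:Z) r = iter k (@mulXY F) (fun e => u e.1 (-1) e.2) (p, r).
Proof.
move=> uL; elim=> [|k ih] p r; first by rewrite subr0.
have -> : -1 - k.+1%:Z = -1 - k%:Z - 1 by lia.
by rewrite uL !ih addrC.
Qed.

Lemma delta_rel_below u Q : delta_rel u -> (forall p r, u p Q r = 0) ->
  forall p q r, q <= Q -> u p q r = 0.
Proof.
move=> uL u0.
have un (n : nat) p r : u p (Q - n%:Z) r = 0.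
  elim: n p r => [|n ih] p r; first by rewrite subr0.
  have -> : Q - n.+1%:Z = Q - n%:Z - 1 by lia.
  by rewrite uL !ih addr0.
move=> p q r le; have <- : Q - (`|(Q - q)%R|%N)%:Z = q by lia.
exact: un.
Qed.

(** Each use of the relation raises p and lowers q + r, so that q or r
    eventually falls in the range where u vanishes. *)
Lemma delta_rel_vanish u Q0 R0 : delta_rel u ->
  (forall p q r, q <= Q0 -> u p q r = 0) ->
  (forall p q r, r <= R0 -> u p q r = 0) ->
  forall p q r, u p q r = 0.
Proof.
move=> uL uQ uR.
have un (n : nat) p q r : (q - Q0) + (r - R0) <= n%:Z -> u p q r = 0.
  elim: n p q r => [|n ih] p q r le.
    by have [/uQ->//|lt] := leP q Q0; apply: uR; lia.
  have := uL (p + 1) q r; rewrite addrK => /esym.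
  by rewrite [u _ (q - 1) r]ih ?[u _ q (r - 1)]ih ?add0r //; lia.
move=> p q r; apply: (un `|((q - Q0) + (r - R0))%R|%N); lia.
Qed.

(** A series killed by x1 - x2 - x0 is determined by its residue in x1 when
    the exponents of x0 are bounded below. The sections with q < -1 follow from
    the relation directly; those with q > -1 by induction on p. *)
Lemma delta_rel_uniq u P0 : delta_rel u ->
  (forall p q r, p < P0 -> u p q r = 0) -> (forall p r, u p (-1) r = 0) ->
  forall p q r, u p q r = 0.
Proof.
move=> uL uP u1.
have ub := delta_rel_below uL u1.
have un (m : nat) : forall p r, u p (-1 + m%:Z) r = 0.
  elim: m => [|m ihm] p r; first exact: u1.
  have up (n : nat) t : u (P0 - 1 + n%:Z) (-1 + m.+1%:Z) t = 0.
    elim: n t => [|n ihn] t; first by apply: uP; lia.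
    have := uL (P0 - 1 + n.+1%:Z) (-1 + m.+1%:Z) (t + 1).
    have -> : -1 + m.+1%:Z - 1 = -1 + m%:Z by lia.
    have -> : P0 - 1 + n.+1%:Z - 1 = P0 - 1 + n%:Z by lia.
    by rewrite ihm ihn addr0 addrK.
  have [/uP->//|le] := ltP p P0.
  by have <- : P0 - 1 + (`|(p - P0 + 1)%R|%N)%:Z = p by lia.
move=> p q r; have [/ub->//|lt] := leP q (-1).
have <- : -1 + (`|(q + 1)%R|%N)%:Z = q by lia.
exact: un.
Qed.

(** The series C(-x0, x2) with its variables listed in the order x2, x0, so
    that [delta_sum] applies to it. *)
Definition sign_swap (C : int -> int -> F) (s t : int) : F := (-1) ^ t * C t s.

Context (M : int).
Implicit Types A B C : int -> int -> F.
Local Notation ds := (delta_sum M).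

Definition bounded_fst A := forall s t, M < s -> A s t = 0.
Definition bounded_snd A := forall s t, M < t -> A s t = 0.

Lemma sign_swap_bounded C : bounded_snd C -> bounded_fst (sign_swap C).
Proof. by move=> CM s t lt; rewrite /sign_swap CM ?mulr0. Qed.

(** The coefficients of the three terms of the Jacobi identity, in the order
    of the identity. Each is a [delta_sum] with the variables permuted; the
    signs come from the expansions in which x0 is replaced by -x0. *)
Definition term1 A p q r := ds A p q r.
Definition term2 B p q r := (-1) ^ (p + 1) * ds B p r q.
Definition term3 C p q r := (-1) ^ p * ds (sign_swap C) q r p.

Lemma term1_rel A : bounded_fst A -> delta_rel (term1 A).
Proof. by move=> AM p q r; exact: delta_sum_rel. Qed.

Lemma term2_rel B : bounded_fst B -> delta_rel (term2 B).
Proof.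
move=> BM p q r; rewrite /term2 (delta_sum_rel charF0 BM p r q).
by rewrite subrK signzD1; ring.
Qed.

Lemma term3_rel C : bounded_snd C -> delta_rel (term3 C).
Proof.
move=> CM p q r; rewrite /term3 (delta_sum_rel charF0 (sign_swap_bounded CM) q r p).
by rewrite signzB1; ring.
Qed.

Lemma term3_res C p r : bounded_snd C -> term3 C p (-1) r = C p r.
Proof.
move=> CM; rewrite /term3 (delta_sum_res charF0 (sign_swap_bounded CM)).
by rewrite /sign_swap mulrA signz_sqr mul1r.
Qed.

Lemma term3_low C P0 : (forall p q, p < P0 -> C p q = 0) ->
  forall p q r, p < P0 -> term3 C p q r = 0.
Proof.
move=> CP p q r lt; rewrite /term3 /delta_sum big1 ?mulr0 // => i _.
by rewrite /sign_swap CP ?mulr0 //; lia.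
Qed.

(** The hypothesis relating C and C' reads C(x0, x2) = C'(-x0, x2 + x0), which
    is the equality of the two sides in the section q = -1; [delta_rel_uniq]
    extends it to all q. *)
Lemma term3_sym C C' P0 : bounded_snd C -> bounded_snd C' ->
  (forall p q, p < P0 -> C p q = 0) -> (forall p q, p < P0 -> C' p q = 0) ->
  (forall p r, C p r = ds (sign_swap C') r (-1) p) ->
  forall p q r, term3 C p q r = (-1) ^ p * term3 C' p r q.
Proof.
move=> CM CM' CP CP' Csk p q r; apply/eqP; rewrite -subr_eq0; apply/eqP.
pose u p q r := term3 C p q r - (-1) ^ p * term3 C' p r q.
rewrite -/(u p q r); move: p q r; apply: (@delta_rel_uniq _ P0).
- move=> p q r; rewrite /u (term3_rel CM) signzB1.
  by have := term3_rel CM' p r q; rewrite !mulNr => ->; ring.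
- by move=> p q r lt; rewrite /u !(@term3_low _ P0) // mulr0 subr0.
- move=> p r; rewrite /u term3_res // Csk /term3 mulrA signz_sqr mul1r.
  by rewrite subrr.
Qed.

Definition jacobi_defect A B C p q r :=
  term1 A p q r - term2 B p q r - term3 C p q r.

Lemma jacobi_defect_rel A B C :
  bounded_fst A -> bounded_fst B -> bounded_snd C ->
  delta_rel (jacobi_defect A B C).
Proof.
move=> AM BM CM p q r; rewrite /jacobi_defect (term1_rel AM) (term2_rel BM).
by rewrite (term3_rel CM); ring.
Qed.

(** The second term vanishes for q small because B does. The other two terms
    have the difference of weak associativity as their section at q = -1, and
    k multiplications by x0 + x2 reach the section at q = -1 - k. *)
Lemma jacobi_defect_low A B C k Q : bounded_fst A -> bounded_snd C ->
  (forall s t, t <= Q -> B s t = 0) ->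
  (forall e, iter k (@mulXY F)
     (fun e => C e.1 e.2 - ds A e.1 (-1) e.2) e = 0) ->
  exists Q0, forall p q r, q <= Q0 -> jacobi_defect A B C p q r = 0.
Proof.
move=> AM CM BQ WA; exists (Order.min Q (-1 - k%:Z)) => p q r.
rewrite le_min => /andP[leQ lek].
have t2 : term2 B p q r = 0.
  by rewrite /term2 /delta_sum big1 ?mulr0 // => i _; rewrite BQ ?mulr0 //; lia.
rewrite /jacobi_defect t2 subr0.
pose u p q r := term1 A p q r - term3 C p q r; rewrite -/(u p q r).
have uL : delta_rel u.
  by move=> a b d; rewrite /u (term1_rel AM) (term3_rel CM); ring.
apply: (delta_rel_below uL) lek => a b; rewrite (delta_rel_iter uL).
have -> : (fun e : int * int => u e.1 (-1) e.2) =
    (fun e => 0 - (C e.1 e.2 - ds A e.1 (-1) e.2)).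
  by apply/funext => -[a' b'] /=; rewrite /u term3_res // /term1; ring.
rewrite iter_mulXYB // WA subr0 iter_mulXYE // big1 // => i _.
by rewrite mulr0.
Qed.

(** Changing the sign of x0 and exchanging x1 with x2 exchanges the first two
    terms, up to the sign that separates them. *)
Lemma jacobi_defect_swap A B C C' P0 : bounded_snd C -> bounded_snd C' ->
  (forall p q, p < P0 -> C p q = 0) -> (forall p q, p < P0 -> C' p q = 0) ->
  (forall p r, C p r = ds (sign_swap C') r (-1) p) ->
  forall p q r,
    jacobi_defect A B C p q r = (-1) ^ p * jacobi_defect B A C' p r q.
Proof.
move=> CM CM' CP CP' Csk p q r.
rewrite /jacobi_defect (term3_sym CM CM' CP CP' Csk) /term1 /term2 signzD1.
have := signz_sqr F p; set e := (-1) ^ p => ee.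
by rewrite !mulrBr !mulrA !mulrN ee !mulNr mul1r; ring.
Qed.

(** Weak associativity for both orders of the first two factors, together with
    the exchange of the two orders, puts the difference in the situation of
    [delta_rel_vanish]. *)
Lemma jacobi_defect_eq0 A B C C' P0 Q k k' :
  bounded_fst A -> bounded_fst B -> bounded_snd C -> bounded_snd C' ->
  (forall s t, t <= Q -> A s t = 0) -> (forall s t, t <= Q -> B s t = 0) ->
  (forall p q, p < P0 -> C p q = 0) -> (forall p q, p < P0 -> C' p q = 0) ->
  (forall p r, C p r = ds (sign_swap C') r (-1) p) ->
  (forall e, iter k (@mulXY F)
     (fun e => C e.1 e.2 - ds A e.1 (-1) e.2) e = 0) ->
  (forall e, iter k' (@mulXY F)
     (fun e => C' e.1 e.2 - ds B e.1 (-1) e.2) e = 0) ->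
  forall p q r, jacobi_defect A B C p q r = 0.
Proof.
move=> AM BM CM CM' AQ BQ CP CP' Csk WA WA'.
have [Q0 jQ] := jacobi_defect_low AM CM BQ WA.
have [R0 jR] := jacobi_defect_low BM CM' AQ WA'.
apply: (delta_rel_vanish (R0 := R0) (jacobi_defect_rel AM BM CM) jQ) => p q r le.
by rewrite (jacobi_defect_swap _ _ CM CM' CP CP' Csk) (jR _ _ _ le) mulr0.
Qed.

End Jacobi.

(** * Functionals on tensor products *)

Lemma linear_bundle (R : nzRingType) (U W : lmodType R) (f : U -> W) :
  linear f -> exists g : {linear U -> W}, f = g.
Proof.
move=> fl; pose t := GRing.isLinear.Build R U W *:%R f fl.
by pose g : {linear U -> W} := HB.pack f t; exists g.
Qed.

Section Functionals.
Context (F : fieldType).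

Lemma scalar_bundle (U : lmodType F) (g : U -> F) :
  scalar g -> exists f : {scalar U}, g = f.
Proof.
move=> gl; pose t := GRing.isLinear.Build F U F *%R g gl.
by pose f : {scalar U} := HB.pack g t; exists f.
Qed.

(** Take H maximal among the sets that are closed under the combinations
    a x + y and do not contain v. Then H is a subspace, H and v span U, and the coefficient of
    v modulo H is the functional. *)
Lemma exists_functional (U : lmodType F) (v : U) :
  v != 0 -> exists g : {scalar U}, g v = 1.
Proof.
move=> v0.
(* The empty set satisfies P, so that the union of an empty chain does. *)
pose P (X : set U) := (forall a x y, X x -> X y -> X (a *: x + y)) /\ ~ X v.
have [H [[Hlin Hv] Hmax]] : exists A, P A /\ forall B, A `<` B -> ~ P B.
  apply: Zorn_bigcup => C CP Ctot; split; last by case=> X /CP[_ nXv] /nXv.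
  move=> a x y [X CX Xx] [X' CX' Xy].
  by have [s|s] := Ctot _ _ CX CX'; [exists X' => //; apply: (CP _ CX').1 => //;
    exact: s | exists X => //; apply: (CP _ CX).1 => //; exact: s].
have H0 : H 0.
  have [[x Hx]|noH] := pselect (exists x, H x).
    by have := Hlin (-1) x x Hx Hx; rewrite scaleN1r addNr.
  exfalso; apply: (Hmax [set 0]).
    split=> [x Hx|]; first by case: noH; exists x.
    by move=> /(_ 0 erefl) H0; apply: noH; exists 0.
  split=> [a x y -> ->|/eqP]; first by rewrite scaler0 addr0.
  by rewrite (negPf v0).
have HZ a x : H x -> H (a *: x).
  by move=> Hx; have := Hlin a x 0 Hx H0; rewrite addr0.
have ex x : exists a, H (x - a *: v).
  have [Hx|nHx] := pselect (H x); first by exists 0; rewrite scale0r subr0.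
  pose B : set U := [set z | exists2 y, H y & exists b, z = y + b *: x].
  have : ~ P B.
    apply: Hmax; split=> [y Hy|]; first by exists y => //; exists 0; rewrite scale0r addr0.
    by move=> /(_ x); apply: contra_not nHx; apply; exists 0 => //; exists 1;
       rewrite scale1r add0r.
  move=> nPB; have [y Hy [b vE]] : B v.
    apply: contrapT => nBv; apply: nPB; split=> // a _ _ [y Hy [b ->]] [z Hz [d ->]].
    exists (a *: y + z); first exact: Hlin.
    by exists (a * b + d); rewrite scalerDr scalerDl !scalerA addrACA.
  have b0 : b != 0.
    by apply/eqP => b0; apply: Hv; rewrite vE b0 scale0r addr0.
  exists b^-1; rewrite vE scalerDr scalerA mulVf // scale1r opprD addrCA subrr addr0.
  by rewrite -scaleNr; exact: HZ.
have uniq x a b : H (x - a *: v) -> H (x - b *: v) -> a = b.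
  move=> Ha Hb; apply/eqP; rewrite -subr_eq0; apply/negP => ab; apply: Hv.
  have := HZ (a - b)^-1 _ (Hlin (-1) _ _ Ha Hb).
  rewrite scaleN1r opprB addrA subrK -scalerBl scalerA mulVf ?scale1r //.
  exact/negP.
pose g x := projT1 (cid (ex x)).
have gP x : H (x - g x *: v) := projT2 (cid (ex x)).
have gl : scalar g.
  move=> a x y; apply: (uniq (a *: x + y)); first exact: gP.
  rewrite scalerDl -scalerA opprD addrACA -scalerBr.
  exact: Hlin.
have [f fE] := scalar_bundle gl; exists f; rewrite -fE.
by apply: (uniq v); [exact: gP | rewrite scale1r subrr].
Qed.

(** The functional g (x) h. The arguments are plain functions, so that they
    can be rewritten by extensionality; linearity is a separate hypothesis. *)
Definition tpair (U W : lmodType F) (g : U -> F) (h : W -> F) : tensor U W -> F :=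
  tlift (W := F^o) (fun u w => g u * h w).

Section Pairing.
Context (U W : lmodType F).
Implicit Types (g : U -> F) (h : W -> F).

Lemma tpair_bilinear g h : scalar g -> scalar h ->
  bilinear_for *:%R *:%R (fun u w => g u * h w : F^o).
Proof.
move=> gl hl; split=> [w a u u'|u a w w'] /=.
  by rewrite gl mulrDl -mulrA.
by rewrite hl mulrDr mulrCA.
Qed.

Lemma tpairE g h : scalar g -> scalar h ->
  forall u w, tpair g h (u *t w) = g u * h w.
Proof. by move=> gl hl u w; exact: (tliftE (tpair_bilinear gl hl)). Qed.

Lemma tpair_scalar g h : scalar g -> scalar h -> scalar (tpair g h).
Proof. by move=> gl hl; exact: (tlift_linear (tpair_bilinear gl hl)). Qed.

Lemma tpair_span g h : scalar g -> scalar h -> forall s : seq (U * W),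
  tpair g h (\sum_(p <- s) p.1 *t p.2) = \sum_(p <- s) g p.1 * h p.2.
Proof.
move=> gl hl s; have [f fE] := scalar_bundle (tpair_scalar gl hl).
by rewrite fE linear_sum -fE; apply: eq_bigr => p _; rewrite tpairE.
Qed.

Lemma tpair_suml n (a : 'I_n -> F) (g : 'I_n -> U -> F) h w :
  tpair (fun u => \sum_i a i * g i u) h w = \sum_i a i * tpair (g i) h w.
Proof.
rewrite /tpair /tlift; under [RHS]eq_bigr do rewrite mulr_sumr.
rewrite exchange_big; apply: eq_bigr => p _ /=.
by rewrite mulr_suml; apply: eq_bigr => i _; rewrite mulrA.
Qed.

Lemma tpair0l h (x : tensor U W) : tpair (fun=> 0) h x = 0.
Proof. by rewrite /tpair /tlift big1 // => t _; exact: mul0r. Qed.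

Lemma tpair0r g (x : tensor U W) : tpair g (fun=> 0) x = 0.
Proof. by rewrite /tpair /tlift big1 // => t _; exact: mulr0. Qed.

Lemma scalar_tensor_ext (f f' : tensor U W -> F) : scalar f -> scalar f' ->
  (forall u w, f (u *t w) = f' (u *t w)) -> f =1 f'.
Proof.
move=> /scalar_bundle[k ->] /scalar_bundle[k' ->] e x.
by have [s ->] := tensor_span x; rewrite !linear_sum; apply: eq_bigr.
Qed.

(** Induction on the length of an expression of x as a sum of pure tensors
    u (x) w. If every g kills the first u, that term is zero. Otherwise the
    pairings with this g express the first w through the others, which gives a
    shorter expression of x. *)
Lemma tpair_separates (P : set (U -> F)) (Q : set (W -> F)) :
  (forall g, P g -> scalar g) -> (forall h, Q h -> scalar h) ->
  (forall u, (forall g, P g -> g u = 0) -> u = 0) ->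
  (forall w, (forall h, Q h -> h w = 0) -> w = 0) ->
  forall x, (forall g h, P g -> Q h -> tpair g h x = 0) -> x = 0.
Proof.
move=> Pl Ql Psep Qsep x x0; have [s xE] := tensor_span x.
have : forall g h, P g -> Q h -> \sum_(p <- s) g p.1 * h p.2 = 0.
  move=> g h Pg Qh; have := x0 _ _ Pg Qh.
  by rewrite xE (tpair_span (Pl _ Pg) (Ql _ Qh)).
rewrite {}xE => {x x0}.
move: {2}(size s) (erefl (size s)) => n.
elim: n s => [|n ih] [|[u w] s] //=.
  by move=> _ _; rewrite big_nil.
move=> [sn] s0; have [bl br] := tens_bilinear U W.
have [[g Pg gu]|nog] := pselect (exists2 g, P g & g u != 0); last first.
  have u0 : u = 0.
    by apply: Psep => g Pg; apply: contrapT => /eqP gu; apply: nog; exists g.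
  have z : 0 *t w = 0 :> tensor U W.
    by have := bl w (-1) 0 0; rewrite /= scaleN1r oppr0 addr0 scaleN1r addNr.
  rewrite big_cons u0 z add0r; apply: ih => // g h Pg Qh.
  have := s0 _ _ Pg Qh; rewrite big_cons /= u0.
  by have [k ->] := scalar_bundle (Pl _ Pg); rewrite linear0 mul0r add0r.
(* w solved from the pairings with this g, then substituted in u (x) w *)
pose b (p : U * W) := - (g u)^-1 * g p.1.
have wE : w = \sum_(p <- s) b p *: p.2.
  apply/eqP; rewrite -subr_eq0; apply/eqP/Qsep => h Qh.
  have [k hk] := scalar_bundle (Ql _ Qh); have := s0 _ _ Pg Qh.
  rewrite hk linearB linear_sum big_cons /= => e.
  apply: (mulfI gu); rewrite mulr0 mulrBr.
  rewrite -[X in X - _](addrK (\sum_(p <- s) g p.1 * k p.2)).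
  rewrite e sub0r -opprD mulr_sumr -big_split big1 ?oppr0 // => p _ /=.
  by rewrite linearZ /= /b; field.
pose t := [seq (p.1 + b p *: u, p.2) | p <- s].
have tE (T : zmodType) (f : U -> W -> T) : \sum_(p <- t) f p.1 p.2 =
   \sum_(p <- s) f (p.1 + b p *: u) p.2 by rewrite big_map.
have -> : \sum_(p <- (u, w) :: s) p.1 *t p.2 = \sum_(p <- t) p.1 *t p.2.
  rewrite big_cons (tE _ (@tens F U W)) /= wE.
  have -> : u *t (\sum_(p <- s) b p *: p.2) = \sum_(p <- s) b p *: (u *t p.2).
    have [L LE] := linear_bundle (br u : linear (tens u)); rewrite LE linear_sum.
    by apply: eq_bigr => p _; rewrite linearZ.
  rewrite -big_split; apply: eq_bigr => p _ /=.
  by rewrite [p.1 + _]addrC; exact/esym/(bl p.2 (b p) u p.1).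
apply: ih => [|g' h Pg' Qh]; first by rewrite size_map.
rewrite (tE _ (fun u w => g' u * h w)); have := s0 _ _ Pg' Qh.
rewrite big_cons /= {1}wE => e; rewrite -[RHS]e {e}.
have [k ->] := scalar_bundle (Ql _ Qh); have [k' ->] := scalar_bundle (Pl _ Pg').
rewrite linear_sum mulr_sumr -big_split; apply: eq_bigr => p _ /=.
by rewrite linearD !linearZ /= mulrDl addrC mulrA [b p * _]mulrC.
Qed.

End Pairing.

Lemma tpair_tmap (U W U' W' : lmodType F) (f : {linear U -> U'})
    (f' : {linear W -> W'}) (g : U' -> F) (h : W' -> F) :
  scalar g -> scalar h ->
  forall x, tpair g h (tmap f f' x) = tpair (g \o f) (h \o f') x.
Proof.
move=> gl hl; have [t tE] := linear_bundle (tmap_linear f f').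
have gfl : scalar (g \o f) by move=> a x y; rewrite /= linearP gl.
have hfl : scalar (h \o f') by move=> a x y; rewrite /= linearP hl.
apply: scalar_tensor_ext; last by move=> u w; rewrite tmapE !tpairE.
  by move=> a x y; rewrite tmap_linear tpair_scalar.
exact: tpair_scalar.
Qed.

Lemma tpair_flip (U W : lmodType F) (g : U -> F) (h : W -> F) :
  scalar g -> scalar h -> forall x, tpair h g (tflip x) = tpair g h x.
Proof.
move=> gl hl; apply: scalar_tensor_ext; [|exact: tpair_scalar|].
  by move=> a x y; rewrite tflip_linear tpair_scalar.
by move=> u w; rewrite tflipE !tpairE // mulrC.
Qed.

Lemma tpair_assoc (U V W : lmodType F) (g : U -> F) (h : V -> F) (k : W -> F) :
  scalar g -> scalar h -> scalar k ->
  forall x, tpair (tpair g h) k (tassoc x) = tpair g (tpair h k) x.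
Proof.
move=> gl hl kl; have hkl := tpair_scalar hl kl; have ghl := tpair_scalar gl hl.
apply: scalar_tensor_ext; [|exact: tpair_scalar|].
  by move=> a x y; rewrite tassoc_linear tpair_scalar.
move=> u x; rewrite tpairE //; move: x; apply: scalar_tensor_ext.
- have [_ br] := tens_bilinear U (tensor V W).
  by move=> a x y; rewrite (br u) tassoc_linear tpair_scalar.
- by move=> a x y; rewrite hkl mulrDr mulrCA.
- by move=> v w; rewrite tassocE !tpairE // mulrA.
Qed.

End Functionals.

(** * Homogeneous functionals *)

Section Gradings.
Context (F : fieldType).

(** The projections to the homogeneous components are linear because the
    decomposition of a vector is unique. *)
Lemma grading_proj (W : lmodType F) (G : int -> set W) : is_grading G ->
  exists pr : int -> {linear W -> W},
   [/\ forall i v, G i v -> pr i v = v,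
       forall i k v, G i v -> k != i -> pr k v = 0 &
       forall w, (forall k, pr k w = 0) -> w = 0].
Proof.
move=> [Gsub Gdec].
pose cmp w := projT1 (cid (Gdec w)).
have cmpP w : [/\ forall k, G k (cmp w k), finite_set [set k | cmp w k != 0] &
    w = \sum_(k \in [set: int]) cmp w k] := (projT2 (cid (Gdec w))).1.
have cmpU w u : (forall k, G k (u k)) -> finite_set [set k | u k != 0] ->
    w = \sum_(k \in [set: int]) u k -> cmp w = u.
  by move=> uG uf wE; exact: (projT2 (cid (Gdec w))).2.
have cmpl k : linear (cmp^~ k).
  move=> a x y /=; have [xG xf xE] := cmpP x; have [yG yf yE] := cmpP y.
  rewrite (@cmpU _ (fun k => a *: cmp x k + cmp y k)) // => [{}k||].
  - exact: (Gsub k).2.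
  - apply: (@sub_finite_set _ _ ([set k | cmp x k != 0] `|` [set k | cmp y k != 0])).
      move=> i /=; have [->|] := eqVneq (cmp x i) 0; last by left.
      by rewrite scaler0 add0r; right.
    by rewrite finite_setU.
  - have [r ur hr] := finite_supp_seq xf; have [s us hs] := finite_supp_seq yf.
    pose t := undup (r ++ s); have ut : uniq t := undup_uniq _.
    have xt e : cmp x e != 0 -> e \in t.
      by rewrite mem_undup mem_cat => /hr ->.
    have yt e : cmp y e != 0 -> e \in t.
      by rewrite mem_undup mem_cat => /hs ->; rewrite orbT.
    rewrite {1}xE {1}yE (fsum_seq ut xt) (fsum_seq ut yt) (fsum_seq ut).
      by rewrite scaler_sumr big_split.
    move=> e; apply: contraNT => et.
    have -> : cmp x e = 0 by apply: contraNeq et; exact: xt.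
    have -> : cmp y e = 0 by apply: contraNeq et; exact: yt.
    by rewrite scaler0 addr0.
have cmpG i v : G i v -> cmp v = fun k => if k == i then v else 0.
  move=> Gv; apply: cmpU => [k||].
  - by case: eqP => [->//|_]; exact: (Gsub k).1.
  - apply: (@sub_finite_set _ _ [set i]) => // k /=.
    by case: (k =P i) => // _; rewrite eqxx.
  - rewrite (@fsum_seq _ _ _ [:: i]) // ?big_seq1 ?eqxx // => e.
    by rewrite inE; case: (e == i) => //; rewrite eqxx.
pose pr k : {linear W -> W} :=
  projT1 (cid (linear_bundle (cmpl k))).
have prE k w : pr k w = cmp w k.
  exact/esym/(congr1 (fun f => f w) (projT2 (cid (linear_bundle (cmpl k))))).
exists pr; split=> [i v Gv|i k v Gv ki|w w0].
- by rewrite prE (cmpG _ _ Gv) eqxx.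
- by rewrite prE (cmpG _ _ Gv) (negPf ki).
- have [_ _ ->] := cmpP w; apply: fsbig1 => k _.
  by rewrite -prE w0.
Qed.

Definition homog (W : lmodType F) (G : int -> set W) (d : int) (g : W -> F) :=
  scalar g /\ forall i v, G i v -> i <> d -> g v = 0.

Lemma graded_scalar_eq0 (W : lmodType F) (G : int -> set W) (g : W -> F) :
  is_grading G -> scalar g -> (forall i v, G i v -> g v = 0) ->
  forall w, g w = 0.
Proof.
move=> [_ Gdec] /scalar_bundle[f ->] g0 w.
have [u [[uG _ ->] _]] := Gdec w.
by rewrite linear_sum big1 // => k _; exact: g0 (uG k).
Qed.

(** A nonzero vector has a nonzero component, and a functional that does not
    vanish on it can be composed with the projection. *)
Lemma homog_separates (W : lmodType F) (G : int -> set W) : is_grading G ->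
  forall w, (forall d g, homog G d g -> g w = 0) -> w = 0.
Proof.
move=> /grading_proj[pr [prG pr0 pr_inj]] w w0.
apply: pr_inj => k; apply: contrapT => /eqP/exists_functional[f f1].
suff: (1 : F) = 0 by apply/eqP; rewrite oner_eq0.
rewrite -f1; apply: (w0 k (f \o pr k)); split=> [a x y|i v Gv ik] /=.
  by rewrite !linearP.
by rewrite (pr0 i) ?linear0 //; apply/eqP => ki; exact: ik.
Qed.

Lemma homog_tpair (U W : lmodType F) (G : int -> set U) (H : int -> set W) d e g h :
  homog G d g -> homog H e h -> homog (tens_grading G H) (d + e) (tpair g h).
Proof.
move=> [gl g0] [hl h0]; split; first exact: tpair_scalar.
move=> n _ [s [-> sG]] nde; rewrite tpair_span // big_seq big1 // => p /sG.
move=> [i [j [ijn Gp Hp]]]; have [->|id] := pselect (g p.1 = 0).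
  by rewrite mul0r.
have [ji|jne] := eqVneq j e; last by rewrite (h0 _ _ Hp) ?mulr0 //; exact/eqP.
by rewrite (g0 _ _ Gp) ?mul0r // => ie; apply: nde; rewrite -ijn ie ji.
Qed.

Lemma homog_graded_dual (W : lmodType F) (G : int -> set W) d (f : {scalar W}) :
  homog G d f -> in_graded_dual G f.
Proof.
move=> [_ f0]; apply: (@sub_finite_set _ _ [set d]) => // k /= [w Gw].
by apply: contraNeq => /eqP kd; apply/eqP; exact: f0 Gw kd.
Qed.

End Gradings.

(** * Products on the graded dual *)

Section Coalgebra.
Context (F : fieldType) (charF0 : [pchar F] =i pred0).
Context (V : lmodType F) (G : int -> set V).
Context (Y : int -> {linear V -> tensor V V}) (c : {scalar V}).
Context (HV : vertex_coalgebra_sans_jacobi G Y c).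
Implicit Types g h : V -> F.

(** The transpose of the coefficient of x^n in Y(x): a product on
    functionals, analogous to the modes of a vertex algebra. *)
Definition dualY (n : int) g h : V -> F := fun v => tpair g h (Y n v).

Lemma dualY_scalar n g h : scalar g -> scalar h -> scalar (dualY n g h).
Proof. by move=> gl hl a x y; rewrite /dualY linearP tpair_scalar. Qed.

Lemma dualY_homog n d e g h : homog G d g -> homog G e h ->
  homog G (d + e + n) (dualY n g h).
Proof.
move=> gd he; have [tl t0] := homog_tpair gd he.
split=> [|r v Gv rn]; first by apply: dualY_scalar; [exact: gd.1 | exact: he.1].
have := @vc_weight _ _ _ _ _ HV r (- n - 1) v Gv.
have -> : - (- n - 1) - 1 = n by lia.
by move=> /t0; apply; lia.
Qed.

(** For n small the degree of the product lies where V has no component. *)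
Lemma dualY_trunc d e g h : homog G d g -> homog G e h ->
  exists N : int, forall n, n < N -> forall v, dualY n g h v = 0.
Proof.
move=> gd he; have [N hN] := vc_lower HV; exists (N - d - e) => n lt.
have [pl p0] := dualY_homog n gd he.
apply: (graded_scalar_eq0 (vc_grading HV) pl) => i v Gv.
have [ii|/eqP/p0] := eqVneq i (d + e + n); last exact.
have : G i v by []; rewrite ii hN; last lia.
by move=> ->; have [f ->] := scalar_bundle pl; rewrite linear0.
Qed.

Lemma ctensl_bilinear : bilinear_for *:%R *:%R (fun u v : V => c u *: v).
Proof.
split=> [v a u u'|u a v v'] /=.
  by rewrite linearP scalerDl scalerA.
by rewrite scalerDr !scalerA mulrC.
Qed.

Lemma ctensr_bilinear : bilinear_for *:%R *:%R (fun u v : V => c v *: u).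
Proof.
split=> [v a u u'|u a v v'] /=.
  by rewrite scalerDr !scalerA mulrC.
by rewrite linearP scalerDl scalerA.
Qed.

Lemma ctensl_flip x : ctensl c (tflip x) = ctensr c x.
Proof.
have [r rE] := linear_bundle (tlift_linear ctensr_bilinear).
have [l lE] := linear_bundle (tlift_linear ctensl_bilinear).
have [t tE] := linear_bundle (@tflip_linear F V V).
rewrite /ctensr /ctensl rE lE tE; have [s ->] := tensor_span x.
rewrite !linear_sum; apply: eq_bigr => p _.
by rewrite -tE tflipE -rE -lE (tliftE ctensr_bilinear) (tliftE ctensl_bilinear).
Qed.

Lemma tpair_counitl h : scalar h -> forall x, tpair c h x = h (ctensl c x).
Proof.
move=> hl; have [l lE] := linear_bundle (tlift_linear ctensl_bilinear).
have [f fE] := scalar_bundle hl.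
apply: scalar_tensor_ext => [||u w].
- by apply: tpair_scalar => //; exact: linearP.
- by move=> a x y; rewrite /ctensl lE fE !linearP.
- rewrite tpairE //; last exact: linearP.
  by rewrite /ctensl (tliftE ctensl_bilinear) fE linearZ.
Qed.

Lemma tpair_counitr g : scalar g -> forall x, tpair g c x = g (ctensr c x).
Proof.
move=> gl; have [l lE] := linear_bundle (tlift_linear ctensr_bilinear).
have [f fE] := scalar_bundle gl.
apply: scalar_tensor_ext => [||u w].
- by apply: tpair_scalar => //; exact: linearP.
- by move=> a x y; rewrite /ctensr lE fE !linearP.
- rewrite tpairE //; last exact: linearP.
  by rewrite /ctensr (tliftE ctensr_bilinear) fE linearZ mulrC.
Qed.

Lemma dualY_counitl n h : scalar h ->
  forall v, dualY n c h v = if n == 0 then h v else 0.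
Proof.
move=> hl v; rewrite /dualY tpair_counitl // (vc_counit HV).
by case: eqP => // _; have [f ->] := scalar_bundle hl; rewrite linear0.
Qed.

(** For v of degree k <> 0, cocreation gives c(v) = (c_k (x) c) Y_0 v, where
    c_i is the restriction of c to degree i. The terms of Y_0 v that survive
    have degrees (k, 0), so this is (c (x) c_0) Y_0 v = c_0(v) = 0 by the
    counit axiom. *)
Lemma counit_homog : homog G 0 c.
Proof.
split=> [|k v Gv k0]; first exact: linearP.
have [pr [prG pr0 _]] := grading_proj (vc_grading HV).
pose g : V -> F := c \o pr k.
have gl : scalar g by move=> a x y; rewrite /g /= !linearP.
have -> : c v = g v by rewrite /g /= (prG _ _ Gv).
pose g0 : V -> F := c \o pr 0.
have g0l : scalar g0 by move=> a x y; rewrite /g0 /= !linearP.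
have cl : scalar c by exact: linearP.
have [s [sE sG]] := @vc_weight _ _ _ _ _ HV k (-1) v Gv.
have {}sE : Y 0 v = \sum_(p <- s) p.1 *t p.2 by rewrite -sE.
transitivity (g0 v); last first.
  by rewrite /g0 /= (pr0 _ _ _ Gv) ?linear0 // eq_sym; exact/eqP.
rewrite -[v in LHS](vc_cocreation HV v).2 -tpair_counitr //.
rewrite -[v in RHS](vc_counit HV v 0) -tpair_counitl // sE !tpair_span //.
rewrite !big_seq; apply: eq_bigr => p /sG[i [j [ij Gp1 Gp2]]] {sE sG}.
rewrite /g /g0 /=; have [ik|ik] := eqVneq i k.
  have j0 : j = 0 by lia.
  by rewrite (prG k) -?ik // (prG 0) // -j0.
rewrite (pr0 _ k _ Gp1) 1?eq_sym // (pr0 _ 0 _ Gp2) ?linear0 ?mulr0 ?mul0r //.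
by apply/eqP; lia.
Qed.

Definition Y_bounded v M := forall n, M < n -> Y n v = 0.

Lemma dualY_bounds v M g h n : Y_bounded v M -> scalar g -> scalar h ->
  M < n -> dualY n g h v = 0.
Proof.
move=> vM gl hl lt; rewrite /dualY vM //.
by have [f ->] := scalar_bundle (tpair_scalar gl hl); exact: linear0.
Qed.

Context (Hskew : skew_symmetry Y c).

(** That is, (Id (x) c) Y(x) = e^(x D* ): apply c (x) Id to skew-symmetry and
    use the counit axiom on Y(-x). *)
Lemma ctensr_Y (n : nat) v :
  ctensr c (Y n%:Z v) = (n`!%:R)^-1 *: iter n (Dstar Y c) v.
Proof.
have [l lE] := linear_bundle (tlift_linear ctensl_bilinear).
have [Yfin YE] := Hskew v n%:Z.
rewrite -ctensl_flip YE /ctensl lE.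
have lY m w : l (Y m w) = if m == 0 then w else 0.
  by rewrite -lE; exact: (vc_counit HV).
rewrite (morph_fsum (linearD l) (linear0 l) Yfin).
rewrite (@fsum_seq _ _ _ [:: n]) // ?big_seq1.
  by rewrite /YexpD subrr expr0z scale1r lY eqxx.
move=> m; rewrite inE /YexpD linearZ /= lY subr_eq0 eqz_nat (eq_sym n).
by case: (m == n) => //; rewrite scaler0 eqxx.
Qed.

Lemma dualY_counitr n g : scalar g -> forall v,
  dualY n g c v = g (ctensr c (Y n v)).
Proof. by move=> gl v; rewrite /dualY tpair_counitr. Qed.

Lemma dualY_counitr_neg n g : scalar g -> n < 0 -> forall v, dualY n g c v = 0.
Proof.
move=> gl lt v; rewrite dualY_counitr // (vc_cocreation HV v).1 //.
by have [f ->] := scalar_bundle gl; rewrite linear0.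
Qed.

(** Skew-symmetry, with (D* )^i / i! replaced by the coefficients of
    (Id (x) c) Y(x). The bound K, which does not depend on v, makes the sum
    an identity between functionals. *)
Lemma dualY_skew n g h (K : nat) : scalar g -> scalar h ->
  (forall i : nat, (K <= i)%N -> forall v, dualY (n - i%:Z) h g v = 0) ->
  forall v, dualY n g h v =
    \sum_(i < K) (-1) ^ (n - i%:Z) * dualY i%:Z (dualY (n - i%:Z) h g) c v.
Proof.
move=> gl hl hK v; have [Yfin YE] := Hskew v n.
rewrite /dualY -tpair_flip // YE; have [f fE] := scalar_bundle (tpair_scalar hl gl).
rewrite fE (morph_fsum (linearD f) (linear0 f) Yfin) -fE.
have hgl i := dualY_scalar (n - i%:Z) hl gl.
have tE (i : nat) : tpair h g (YexpD Y c v n i) =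
    (-1) ^ (n - i%:Z) * dualY i%:Z (dualY (n - i%:Z) h g) c v.
  rewrite /YexpD fE linearZ -fE dualY_counitr //= ctensr_Y //.
rewrite (@fsum_nat _ _ id K) => [|//|i].
  by apply: eq_bigr => i _; exact: tE.
rewrite tE dualY_counitr // => ne; exists i => //; rewrite ltnNge.
by apply: contra ne => /hK ->; rewrite mulr0.
Qed.

Lemma Y_sumE v p q : Y_sum Y v (p, q) =
  if q is Posz i then gbinom F (p + i%:Z) i *: Y (p + i%:Z) v else 0.
Proof.
rewrite /Y_sum (@fsum_seq _ _ _ [:: p + q]) // ?big_seq1.
  case: q => [i|i]; rewrite /binom_series ?scale0r //.
  by rewrite eqxx expr1n mulr1.
move=> n; rewrite inE /binom_series; case: q => [i|i]; rewrite ?scale0r ?eqxx //.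
by rewrite [n == _]eq_sym; case: (_ == n) => //; rewrite scale0r eqxx.
Qed.

Lemma IdY_linear n : linear (@IdY F V Y n).
Proof.
by move=> a x y; rewrite /IdY /= tmap_linear tassoc_linear.
Qed.

Lemma tpair_IdY g1 g2 g3 n x : scalar g1 -> scalar g2 -> scalar g3 ->
  tpair (tpair g1 g2) g3 (IdY Y n x) = tpair g1 (dualY n g2 g3) x.
Proof.
move=> l1 l2 l3; rewrite /IdY /= tpair_assoc // (@tpair_tmap _ _ _ _ _ idfun (Y n)) //.
exact: tpair_scalar.
Qed.

Lemma tpair_YId g1 g2 g3 n x : scalar g1 -> scalar g2 -> scalar g3 ->
  tpair (tpair g1 g2) g3 (YId Y n x) = tpair (dualY n g1 g2) g3 x.
Proof.
move=> l1 l2 l3; rewrite /YId (@tpair_tmap _ _ _ _ _ (Y n) idfun) //.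
exact: tpair_scalar.
Qed.

Lemma tpair_flip12 g1 g2 g3 x : scalar g1 -> scalar g2 -> scalar g3 ->
  tpair (tpair g1 g2) g3 (tmap (@tflip F V V) idfun x) = tpair (tpair g2 g1) g3 x.
Proof.
move=> l1 l2 l3; have [t tE] := linear_bundle (@tflip_linear F V V).
rewrite tE (@tpair_tmap _ _ _ _ _ t idfun) //; last exact: tpair_scalar.
by congr (tpair _ _ x); apply/funext => y /=; rewrite -tE tpair_flip.
Qed.

(** The pairings of (Id (x) Y(x2)) Y(x1) v, respectively of
    (Y(x0) (x) Id) Y(x2) v, with g1 (x) g2 (x) g3. The exponents are listed in
    the order x1, x2, respectively x0, x2. *)
Definition right_nested g1 g2 g3 v (q r : int) := dualY q g1 (dualY r g2 g3) v.
Definition left_nested g1 g2 g3 v (p q : int) := dualY q (dualY p g1 g2) g3 v.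

Context (Hcoassoc : weak_coassociativity G Y).

(** The section q = -1 of [delta_sum] is the expansion of the right-nested
    product at x1 = x0 + x2. *)
Lemma dualY_weak_assoc d1 d2 d3 g1 g2 g3 :
  homog G d1 g1 -> homog G d2 g2 -> homog G d3 g3 ->
  exists k : nat, forall v M, Y_bounded v M -> forall e,
    iter k (@mulXY F)
     (fun e => left_nested g1 g2 g3 v e.1 e.2
         - delta_sum M (right_nested g1 g2 g3 v) e.1 (-1) e.2) e = 0.
Proof.
move=> h1 h2 h3; have [l1 l2 l3] : [/\ scalar g1, scalar g2 & scalar g3].
  by split; [exact: h1.1 | exact: h2.1 | exact: h3.1].
have hf := homog_tpair (homog_tpair h1 h2) h3.
have [f fE] := scalar_bundle hf.1; rewrite fE in hf.
have [k [_ hk]] := Hcoassoc (homog_graded_dual hf).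
exists k => v M vM e; have := congr1 (fun u => u e) (hk v).
rewrite smul_binom_mulXY // => <-; congr (iter k _ _ _); apply/funext => -[p q] /=.
rewrite linearB -fE tpair_YId //; congr (_ - _).
have hl := tpair_scalar (tpair_scalar l1 l2) l3.
have I0 m : IdY Y m 0 = 0.
  by have [t ->] := linear_bundle (IdY_linear m); rewrite linear0.
pose n := `|(M - (p - 1))%R|%N.
rewrite /IdY_Y_sum (@fsum_nat _ _ Posz n) => [|i j []//|[i|i]]; last 2 first.
- rewrite Y_sumE => ne; exists i => //; rewrite ltnNge; apply: contra ne => le.
  by rewrite vM ?scaler0 ?I0 //; rewrite /n in le; lia.
- by rewrite Y_sumE I0 eqxx.
rewrite fE linear_sum -fE /delta_sum; apply: eq_bigr => i _.
rewrite Y_sumE tpair_IdY //.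
have [t tE] := scalar_bundle (tpair_scalar l1 (dualY_scalar (q - i%:Z) l2 l3)).
rewrite tE linearZ -tE /= /right_nested /dualY.
by congr (_ * tpair _ _ (Y _ v)); rewrite subrK.
Qed.

(** By the counit axiom only the constant term in x2 of the inner product
    survives, and what is left is the expansion of x1 = x0 + x2. *)
Lemma delta_sum_counit g h v M p s : scalar g -> scalar h -> Y_bounded v M ->
  delta_sum M (right_nested g c h v) p (-1) s =
    pascal F p s * dualY (p + s) g h v.
Proof.
move=> gl hl vM; have cl := counit_homog.1.
have AM a b : M < a -> right_nested g c h v a b = 0.
  by move=> lt; apply: (dualY_bounds vM) => //; exact: dualY_scalar.
have A0 a b : right_nested g c h v a b = if b == 0 then dualY a g h v else 0.
  rewrite /right_nested; have -> : dualY b c h = if b == 0 then h else fun=> 0.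
    by apply/funext => w; rewrite dualY_counitl //; case: (b == 0).
  by case: (b == 0) => //; exact: tpair0r.
rewrite -(@delta_sum_widen _ _ _ AM (`|(M - (p - 1))%R|%N + `|s|%N.+1)%N); last lia.
rewrite /pascal; case: s => [m|m]; last first.
  by rewrite mul0r big1 // => i _; rewrite A0 ifF ?mulr0 //; lia.
have lt : (m < `|(M - (p - 1))%R|%N + `|m%:Z|%N.+1)%N by lia.
rewrite (bigD1 (Ordinal lt)) //= big1 ?addr0 => [|i /eqP ne].
  by rewrite A0 subrr eqxx subrK.
rewrite A0 ifF ?mulr0 //; apply/negP => /eqP e; apply: ne; apply: val_inj => /=.
lia.
Qed.

(** This is (D* (x) Id) Y(x) = d/dx Y(x) in the form of Taylor's formula
    (e^(x0 D* ) (x) Id) Y(x2) = Y(x2 + x0). Weak coassociativity with c in the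
    middle gives it after multiplication by a power of x0 + x2, with the other
    expansion of Y(x0 + x2); a larger power makes the expansions agree, since
    [dualY n g h] vanishes for n small. Both sides have nonnegative powers of
    x0, so that the power of x0 + x2 can be cancelled. *)
Lemma dualY_deriv d e g h : homog G d g -> homog G e h ->
  forall p r v, dualY r (dualY p g c) h v = pascal F r p * dualY (r + p) g h v.
Proof.
move=> hg hh p r v; have [k hk] := dualY_weak_assoc hg counit_homog hh.
have [N hN] := dualY_trunc hg hh.
have [M vM] := vc_truncation HV v.
have gl := hg.1; have hl := hh.1; have cl := counit_homog.1.
pose a n := dualY n g h v.
pose u (e : int * int) :=
  left_nested g c h v e.1 e.2 - pascal F e.2 e.1 * a (e.1 + e.2).
suff u0 : forall e, u e = 0.
  by have := u0 (p, r) => /eqP; rewrite /u subr_eq0 /a /= addrC => /eqP.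
have u_neg b s : b < 0 -> u (b, s) = 0.
  case: b => // b _; rewrite /u /= mul0r subr0 /left_nested.
  have -> : dualY (Negz b) g c = fun=> 0.
    by apply/funext => w; exact: dualY_counitr_neg.
  exact: tpair0l.
(* k powers for weak coassociativity, |N| powers for the two expansions *)
pose K := (k + `|N|)%N.
apply: (mulXY_inj (k := K) u_neg) => -[b s].
have -> : u = (fun e => (left_nested g c h v e.1 e.2
      - delta_sum M (right_nested g c h v) e.1 (-1) e.2)
    - a (e.1 + e.2) * (pascal F e.2 e.1 - pascal F e.1 e.2)).
  apply/funext => -[b' s'] /=; rewrite /u /= delta_sum_counit // -/(a _); ring.
rewrite iter_mulXYB // (iter_mulXY_pascal charF0).
rewrite /K addnC iterD iter_mulXYE // big1 => [|i _].
  have [le|lt] := leP 0 (b + s); first by rewrite (pascal_sym charF0 le) subrr mulr0 subrr.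
  by rewrite /a hN ?mul0r ?subrr //; lia.
by rewrite hk // mulr0.
Qed.

(** C(x0, x2) = C'(-x0, x2 + x0): skew-symmetry in the inner product, followed
    by the translation of x2. *)
Lemma left_nested_skew d1 d2 d3 g1 g2 g3 :
  homog G d1 g1 -> homog G d2 g2 -> homog G d3 g3 ->
  forall v M, Y_bounded v M -> forall p r,
  left_nested g1 g2 g3 v p r =
    delta_sum M (sign_swap (left_nested g2 g1 g3 v)) r (-1) p.
Proof.
move=> h1 h2 h3 v M vM p r.
have [N hN] := dualY_trunc h2 h1.
have [l1 l2 l3] : [/\ scalar g1, scalar g2 & scalar g3].
  by split; [exact: h1.1 | exact: h2.1 | exact: h3.1].
have CM : bounded_fst M (sign_swap (left_nested g2 g1 g3 v)).
  apply: sign_swap_bounded => s t lt.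
  apply: (dualY_bounds vM) => //; exact: dualY_scalar.
(* one cutoff for both the skew-symmetry sum and the translation sum *)
pose K := (`|(p - N)%R|%N.+1 + `|(M - (r - 1))%R|%N)%N.
rewrite -(@delta_sum_widen _ _ _ CM K); last by rewrite /K; lia.
rewrite /left_nested; have -> : dualY p g1 g2 = fun u =>
    \sum_(i < K) (-1) ^ (p - i%:Z) * dualY i%:Z (dualY (p - i%:Z) g2 g1) c u.
  apply/funext => u; apply: dualY_skew => // i le w.
  by apply: hN; rewrite /K in le; lia.
rewrite [LHS]/dualY (tpair_suml (fun i : 'I_K => _) (fun i : 'I_K => _)).
apply: eq_bigr => i _.
rewrite -[tpair _ _ _]/(dualY r _ _ v) (dualY_deriv (dualY_homog _ h2 h1) h3).
rewrite /pascal /sign_swap /left_nested subrK; ring.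
Qed.

End Coalgebra.

(** * The Jacobi identity *)

Section JacobiTerms.
Context (F : fieldType) (V : lmodType F) (Y : int -> {linear V -> tensor V V}).
Context (v : V) (M : int) (vM : Y_bounded Y v M).
Context (g1 g2 g3 : V -> F).
Context (l1 : scalar g1) (l2 : scalar g2) (l3 : scalar g3).

Lemma YId0 n : YId Y n 0 = 0.
Proof.
have [t E] := linear_bundle (@tmap_linear F _ _ _ _ (Y n) (@idfun V)).
by rewrite /YId E linear0.
Qed.

Lemma IdY0 n : IdY Y n 0 = 0.
Proof. by have [t ->] := linear_bundle (@IdY_linear F V Y n); rewrite linear0. Qed.

Lemma flip12_0 : tmap (@tflip F V V) (@idfun V) 0 = 0.
Proof.
have [t tE] := linear_bundle (@tflip_linear F V V).
have [T E] := linear_bundle (@tmap_linear F _ _ _ _ t (@idfun V)).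
by rewrite tE E linear0.
Qed.

Lemma smul_term1 p q r :
  tpair (tpair g1 g2) g3 (smul (@delta_12_0 F) (IdY2_Y1 Y v) (p, q, r)) =
  term1 M (right_nested Y g1 g2 g3 v) p q r.
Proof.
rewrite /smul (@fsum_nat _ _ (fun i : nat => (p, - p - 1 - i%:Z, i%:Z))
   `|(M - (p + q))%R|%N) => [|i j []//|]; last first.
  move=> [[a b] d]; rewrite scaler_eq0 negb_or mulf_eq0 negb_or.
  move=> /andP[/andP[_]]; rewrite /binom_series; case: d => [i|i]; rewrite ?eqxx //.
  case: (_ =P - a - 1) => [bE _|]; rewrite ?eqxx //=.
  case: (_ - a =P 0) => [/subr0_eq aE|]; rewrite ?eqxx // => ne.
  exists i; last by congr (_, _, _); lia.
  rewrite ltnNge; apply: contra ne => le.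
  by rewrite vM ?IdY0 //; lia.
have fl := tpair_scalar (tpair_scalar l1 l2) l3; have [f fE] := scalar_bundle fl.
rewrite fE linear_sum -fE /term1 /delta_sum; apply: eq_bigr => i _.
rewrite fE linearZ -fE /= /delta_series /= exp1rz mul1r subrK eqxx gbinom_neg //.
rewrite subrr eqxx.
by rewrite tpair_IdY // /right_nested /dualY; congr (_ * tpair _ _ (Y _ v)); ring.
Qed.

Lemma smul_term2 p q r :
  tpair (tpair g1 g2) g3 (smul (@delta_21_0 F) (T_IdY1_Y2 Y v) (p, q, r)) =
  term2 M (right_nested Y g2 g1 g3 v) p q r.
Proof.
rewrite /smul (@fsum_nat _ _ (fun i : nat => (p, i%:Z, - p - 1 - i%:Z))
   `|(M - (p + r))%R|%N) => [|i j []//|]; last first.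
  move=> [[a b] d]; rewrite scaler_eq0 negb_or mulf_eq0 negb_or.
  move=> /andP[/andP[_]]; rewrite /binom_series; case: b => [i|i]; rewrite ?eqxx //.
  case: (_ =P - a - 1) => [bE _|]; rewrite ?eqxx //=.
  case: (_ - a =P 0) => [/subr0_eq aE|]; rewrite ?eqxx // => ne.
  exists i; last by congr (_, _, _); lia.
  rewrite ltnNge; apply: contra ne => le.
  by rewrite vM ?IdY0 ?flip12_0 //; lia.
have fl := tpair_scalar (tpair_scalar l1 l2) l3; have [f fE] := scalar_bundle fl.
rewrite fE linear_sum -fE /term2 /delta_sum mulr_sumr; apply: eq_bigr => i _.
rewrite fE linearZ -fE /= /delta_series /= subrK eqxx gbinom_neg //.
rewrite subrr eqxx -mulrA.
rewrite tpair_flip12 // tpair_IdY // /right_nested /dualY.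
by congr (_ * (_ * tpair _ _ (Y _ v))); ring.
Qed.

Lemma smul_term3 p q r :
  tpair (tpair g1 g2) g3 (smul (@delta_10_2 F) (Y0Id_Y2 Y v) (p, q, r)) =
  term3 M (left_nested Y g1 g2 g3 v) p q r.
Proof.
rewrite /smul (@fsum_nat _ _ (fun i : nat => (i%:Z, q, - q - 1 - i%:Z))
   `|(M - (q + r))%R|%N) => [|i j []//|]; last first.
  move=> [[a b] d]; rewrite scaler_eq0 negb_or mulf_eq0 negb_or.
  move=> /andP[/andP[_]]; rewrite /binom_series; case: a => [i|i]; rewrite ?eqxx //.
  case: (_ =P - d - 1) => [bE _|]; rewrite ?eqxx //=.
  case: (_ - b =P 0) => [/subr0_eq aE|]; rewrite ?eqxx // => ne.
  exists i; last by congr (_, _, _); lia.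
  rewrite ltnNge; apply: contra ne => le.
  by rewrite vM ?YId0 //; lia.
have fl := tpair_scalar (tpair_scalar l1 l2) l3; have [f fE] := scalar_bundle fl.
rewrite fE linear_sum -fE /term3 /delta_sum mulr_sumr; apply: eq_bigr => i _.
rewrite fE linearZ -fE /= /delta_series /= exp1rz mul1r.
have -> : - (- q - 1 - i%:Z) - 1 = q + i%:Z by lia.
rewrite eqxx subrr eqxx tpair_YId // /sign_swap [RHS]mulrCA
  [X in _ = _ * X]mulrA signzBn -mulrA.
by rewrite /left_nested /dualY; congr (_ * (_ * tpair _ _ (Y _ v))); ring.
Qed.

End JacobiTerms.

Theorem proposition3p4 (F : fieldType) (charF0 : [pchar F] =i pred0)
    (V : lmodType F) (G : int -> set V)
    (Y : int -> {linear V -> tensor V V}) (c : {scalar V})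
    (HV : vertex_coalgebra_sans_jacobi G Y c)
    (Hcoassoc : weak_coassociativity G Y)
    (Hskew : skew_symmetry Y c) :
  jacobi_identity Y.
Proof.
move=> v; apply/funext => -[[p q] r]; apply: subr0_eq.
have Gsep := homog_separates (vc_grading HV).
pose Q : set (V -> F) := [set g | exists d, homog G d g].
have Ql g : Q g -> scalar g by case=> d [].
have Qsep w : (forall g, Q g -> g w = 0) -> w = 0.
  by move=> w0; apply: Gsep => d g gd; apply: w0; exists d.
pose P : set (tensor V V -> F) :=
  [set f | exists g h, [/\ Q g, Q h & f = tpair g h]].
have Pl f : P f -> scalar f.
  by move=> [g [h [Qg Qh ->]]]; apply: tpair_scalar; exact: Ql.
apply: (tpair_separates Pl Ql _ Qsep)
  => [w w0|_ g3 [g1 [g2 [[d1 h1] [d2 h2] ->]]] [d3 h3]].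
  by apply: (tpair_separates Ql Ql Qsep Qsep) => g h Qg Qh; apply: w0; exists g, h.
have [l1 l2 l3] : [/\ scalar g1, scalar g2 & scalar g3].
  by split; [exact: h1.1 | exact: h2.1 | exact: h3.1].
have [M vM] := vc_truncation HV v.
have [f fE] := scalar_bundle (tpair_scalar (tpair_scalar l1 l2) l3).
rewrite fE !linearB /= -fE (smul_term1 vM) // (smul_term2 vM) //.
rewrite (smul_term3 vM) //.
have [k hk] := dualY_weak_assoc charF0 Hcoassoc h1 h2 h3.
have [k' hk'] := dualY_weak_assoc charF0 Hcoassoc h2 h1 h3.
have [N12 hN12] := dualY_trunc HV h1 h2.
have [N21 hN21] := dualY_trunc HV h2 h1.
have [N13 hN13] := dualY_trunc HV h1 h3.
have [N23 hN23] := dualY_trunc HV h2 h3.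
apply: (@jacobi_defect_eq0 _ charF0 M _ _ _ (left_nested Y g2 g1 g3 v)
   (Order.min N12 N21)
   (Order.min N13 N23 - 1) k k').
- by move=> s t lt; apply: (dualY_bounds vM) => //; exact: dualY_scalar.
- by move=> s t lt; apply: (dualY_bounds vM) => //; exact: dualY_scalar.
- by move=> s t lt; apply: (dualY_bounds vM) => //; exact: dualY_scalar.
- by move=> s t lt; apply: (dualY_bounds vM) => //; exact: dualY_scalar.
- move=> s t le; rewrite /right_nested; have -> : dualY Y t g2 g3 = fun=> 0.
    by apply/funext => w; apply: hN23; lia.
  exact: tpair0r.
- move=> s t le; rewrite /right_nested; have -> : dualY Y t g1 g3 = fun=> 0.
    by apply/funext => w; apply: hN13; lia.
  exact: tpair0r.
- move=> s t lt; rewrite /left_nested; have -> : dualY Y s g1 g2 = fun=> 0.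
    by apply/funext => w; apply: hN12; lia.
  exact: tpair0l.
- move=> s t lt; rewrite /left_nested; have -> : dualY Y s g2 g1 = fun=> 0.
    by apply/funext => w; apply: hN21; lia.
  exact: tpair0l.
- exact: (left_nested_skew charF0 HV Hskew Hcoassoc h1 h2 h3 vM).
- exact: hk.
- exact: hk'.
Qed.
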